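(* Let $d,n\ge1$ and let $f$ be a $\mathbb{C}^{n\times n}$-valued function of $d$ complex variables (see the domain convention in the context). The following statements are equivalent: (0) $f\in\mathbb{R}\mathcal{B}_d^{n\times n}$. (1) $f\in\mathbb{R}\mathcal{B}_d^{\rm rat}(\mathbb{C}^n)$. (2) There exist $\mathbb{C}^{n\times n}$-valued functions $\Phi_k(w,z)$, $k=1,\dots,d$, real rational as functions of $z=(z_1,\dots,z_d)$ and $\overline{w}=(\overline{w}_1,\dots,\overline{w}_d)$, which are positive kernels on $\Omega_d$ satisfying $$\Phi_k(\lambda w,\lambda z)=\Phi_k(w,z),\qquad w,z\in\Omega_d,\ \lambda\in\mathbb{C}\setminus\{0\},\ k=1,\dots,d,$$ and $$f(z)=\sum_{k=1}^dz_k\Phi_k(w,z),\qquad w,z\in\Omega_d.$$ (2$'$) There exist real rational $\mathbb{C}^{N_k\times n}$-valued functions $\phi_k$, with some $N_k\in\mathbb{N}$, $k=1,\dots,d$, with no singularities on $\Omega_d$, that satisfy $$\phi_k(\lambda z)=\phi_k(z),\qquad z\in\Omega_d,\ \lambda\in\mathbb{C}\setminus\{0\},\ k=1,\dots,d,$$ and $$f(z)=\sum_{k=1}^dz_k\phi_k(w)^*\phi_k(z),\qquad w,z\in\Omega_d.$$ (3) There exist $m,m_1,\dots,m_d\in\mathbb{Z}_+$, with $m=m_1+\cdots+m_d$, and a matrix $$U=\begin{bmatrix} A & B \\ C & D \end{bmatrix}\in\mathbb{R}^{(m+n)\times(m+n)}$$ (with $A$ of size $m\times m$ and $D$ of size $n\times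 n$) which is symmetric and orthogonal, i.e., $U^{-1}=U^{\top}=U$, such that the double Cayley transform $\mathcal{F}=\mathcal{C}(f)$ has the representation $$\mathcal{F}(\zeta)=D+C(I_m-P(\zeta)A)^{-1}P(\zeta)B,\qquad \zeta\in\mathbb{D}^d,\qquad P(\zeta)=\operatorname{Diag}[\zeta_1I_{m_1},\dots,\zeta_dI_{m_d}],$$ and $1\notin\sigma(\mathcal{F}(0))$.
   Context: Notation: $\Pi=\{z\in\mathbb{C}:\operatorname{Re}z>0\}$, $\Pi^d$ is its $d$-fold product, $\mathbb{D}^d$ is the open unit polydisk, $\mathbb{T}$ the unit circle, and $\Omega_d=\bigcup_{\lambda\in\mathbb{T}}(\lambda\Pi)^d\subset\mathbb{C}^d$; $\sigma$ denotes spectrum. Bars over vectors and matrices denote entrywise complex conjugation. A matrix-valued function is rational if its entries are quotients of polynomials; rational functions agreeing on a nonempty open set are identified. A matrix-valued function $g$ is real if $g(\bar z)=\overline{g(z)}$; for functions $\Phi$ of $(w,z)$ this means $\Phi(\bar w,\bar z)=\overline{\Phi(w,z)}$. Domain convention: $f$ is a function on $\Pi^d$, identified with its holomorphic (rational) continuation when there is one; conditions (0)--(2$'$), which concern functions on $\Omega_d$ or rational functions, mean that $f$ is the restriction to $\Pi^d$ of a function with the stated property. Class $\mathbb{R}\mathcal{B}_d^{n\times n}$: rational $\mathbb{C}^{n\times n}$-valued functions $f$ for which there exist $m\ge0$ and real symmetric positive semidefinite matrices $A_1,\dots,A_d\in\mathbb{R}^{(n+m)\times(n+m)}$ such that, with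 $A(z)=z_1A_1+\cdots+z_dA_d=\begin{bmatrix} A_{11}(z) & A_{12}(z) \\ A_{21}(z) & A_{22}(z) \end{bmatrix}$ ($A_{11}$ of size $n\times n$, $A_{22}$ of size $m\times m$), $\det A_{22}\not\equiv0$ and $$f(z)=A_{11}(z)-A_{12}(z)A_{22}(z)^{-1}A_{21}(z).\qquad( * )$$ An anti-unitary involution of a Hilbert space $\mathcal{H}$ is a map $\iota:\mathcal{H}\to\mathcal{H}$ with $\iota^2=I_{\mathcal{H}}$ and $\langle\iota u_1,\iota u_2\rangle=\langle u_2,u_1\rangle$ for all $u_1,u_2$; a bounded operator $T$ on $\mathcal{H}$ is $\iota$-real if $\iota T=T\iota$. Class $\mathbb{R}\mathcal{B}_d^{\rm rat}(\mathbb{C}^n)$: rational functions $f$, holomorphic on $\Omega_d$, for which there exist a (possibly infinite-dimensional) Hilbert space $\mathcal{H}$, an anti-unitary involution $\iota_{\mathcal{H}}$ of $\mathcal{H}$, and positive semidefinite bounded operators $A_1,\dots,A_d$ on $\mathbb{C}^n\oplus\mathcal{H}$ which are $\iota\oplus\iota_{\mathcal{H}}$-real, with $\iota$ the entrywise complex conjugation on $\mathbb{C}^n$, such that $( * )$ holds on $\Omega_d$ for $A(z)=z_1A_1+\cdots+z_dA_d$ decomposed into blocks with respect to $\mathbb{C}^n\oplus\mathcal{H}$, with $A_{22}(z)$ invertible for $z\in\Omega_d$. Positive kernel: a function $\Theta:\Lambda\times\Lambda\to\mathbb{C}^{n\times n}$ is a positive kernel on $\Lambda$ if $\sum_{i,j=1}^N\langle\Theta(\lambda_i,\lambda_j)u_j,u_i\rangle\ge0$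 for all $N$, all $\lambda_1,\dots,\lambda_N\in\Lambda$ and all $u_1,\dots,u_N\in\mathbb{C}^n$. Double Cayley transform: $\mathcal{F}=\mathcal{C}(f)$ is $$\mathcal{F}(\zeta)=\Big(f\big(\tfrac{1+\zeta_1}{1-\zeta_1},\dots,\tfrac{1+\zeta_d}{1-\zeta_d}\big)-I_n\Big)\Big(f\big(\tfrac{1+\zeta_1}{1-\zeta_1},\dots,\tfrac{1+\zeta_d}{1-\zeta_d}\big)+I_n\Big)^{-1},\quad\zeta\in\mathbb{D}^d;$$ condition (3) includes the requirement that it is defined, i.e. that $f(z)+I_n$ is invertible for all $z\in\Pi^d$. *)

(* Defs.v *)
From HB Require Import structures.
From mathcomp Require Import all_boot all_order all_algebra.
From mathcomp Require Import sesquilinear spectral.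
From mathcomp Require Import all_classical all_reals all_analysis.
From mathcomp Require Import complex.
(* The notations of mpoly clash with those of mathcomp-analysis. *)
From mathcomp Require Import -(notations) mpoly.

Set Implicit Arguments.
Unset Strict Implicit.
Unset Printing Implicit Defensive.

Import Order.TTheory GRing.Theory Num.Theory.
Import numFieldNormedType.Exports.

Local Open Scope classical_set_scope.
Local Open Scope sesquilinear_scope.
Local Open Scope ring_scope.

(* Points of C^d are row vectors; functions on a subset of C^d are total
   functions whose values off that subset are never used. *)

Section Domains.
Context {R : realType} (d : nat).
Local Notation C := R[i].

Definition polyhalfplane : set 'rV[C]_d :=
  [set z | forall k, 0 < complex.Re (z 0 k)].

Definition polydisk : set 'rV[C]_d := [set zeta | forall k, `|zeta 0 k| < 1].

Definition Omega : set 'rV[C]_d :=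
  [set z | exists lambda : C, `|lambda| = 1 /\
     exists2 v, polyhalfplane v & z = lambda *: v].

Definition Omega2 : set 'rV[C]_(d + d) :=
  [set x | Omega (lsubmx x) /\ Omega (rsubmx x)].

End Domains.

Arguments polyhalfplane {R d} _.
Arguments polydisk {R d} _.
Arguments Omega {R d} _.
Arguments Omega2 {R d} _.

(* For K = R[i] this is complex Frechet differentiability, the scalars of the
   normed modules 'rV[K]_d and K^o being K. *)
Definition holomorphic_on (K : numFieldType) (d p q : nat) (S : set 'rV[K]_d)
    (F : 'rV[K]_d -> 'M[K]_(p, q)) :=
  forall i j (z : 'rV[K]_d), S z ->
    differentiable ((fun x => F x i j) : 'rV[K]_d -> K^o) z.

Section MatrixFunctions.
Context {R : realType} {d p q : nat}.
Local Notation C := R[i].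
Implicit Types (S : set 'rV[C]_d) (F : 'rV[C]_d -> 'M[C]_(p, q)).

(* Nothing is said where the chosen denominator vanishes; together with
   [holomorphic_on S F] this says that F is, on the open set S, a rational
   function without singularities in S. *)
Definition rational_on S F := forall i j, exists P Q : mpoly d C,
  Q != 0 /\ forall z, S z -> meval (z 0) Q != 0 ->
    F z i j = meval (z 0) P / meval (z 0) Q.

Definition real_on S F := forall z, S z ->
  F (map_mx Num.conj z) = map_mx Num.conj (F z).

Definition restriction_of (f : 'rV[C]_d -> 'M[C]_(p, q))
    (P : ('rV[C]_d -> 'M[C]_(p, q)) -> Prop) :=
  exists2 F, (forall z, polyhalfplane z -> f z = F z) & P F.

End MatrixFunctions.

Section Kernels.
Context {R : realType} {d n : nat}.
Local Notation C := R[i].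

Definition cdot (u v : 'cV[C]_n) : C := (v ^t* *m u) 0 0.

Definition positive_kernel (L : set 'rV[C]_d)
    (Theta : 'rV[C]_d -> 'rV[C]_d -> 'M[C]_n) :=
  forall N (l : 'I_N -> 'rV[C]_d) (u : 'I_N -> 'cV[C]_n),
    (forall i, L (l i)) ->
    0 <= \sum_i \sum_j cdot (Theta (l i) (l j) *m u j) (u i).

(* Phi as a function of the 2d variables (conj w, z). *)
Definition conj_left (Phi : 'rV[C]_d -> 'rV[C]_d -> 'M[C]_n)
    (x : 'rV[C]_(d + d)) : 'M[C]_n :=
  Phi (map_mx Num.conj (lsubmx x)) (rsubmx x).

End Kernels.

Section RealBessmertnyi.
Context {R : realType} {d n : nat}.
Local Notation C := R[i].

Definition real_psd_mx k (A : 'M[R]_k) :=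
  A^T = A /\ forall x : 'cV[R]_k, 0 <= (x^T *m A *m x) 0 0.

Definition mx_pencil k (A : 'I_d -> 'M[R]_k) (z : 'rV[C]_d) : 'M[C]_k :=
  \sum_(j < d) z 0 j *: map_mx (real_complex R) (A j).

Definition schur_compl m (M : 'M[C]_(n + m)) : 'M[C]_n :=
  ulsubmx M - ursubmx M *m invmx (drsubmx M) *m dlsubmx M.

(* The value of F is left free where det A22 vanishes, as for any representative
   of a rational function. This never happens on the poly-halfplane: since the
   A j are positive semidefinite and det A22 is not identically zero, A22(z) is
   invertible there. *)
Definition RB_class (F : 'rV[C]_d -> 'M[C]_n) :=
  rational_on setT F /\
  exists m (A : 'I_d -> 'M[R]_(n + m)),
    [/\ forall j, real_psd_mx (A j),
        exists z, \det (drsubmx (mx_pencil A z)) != 0 &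
        forall z, \det (drsubmx (mx_pencil A z)) != 0 ->
          F z = schur_compl (mx_pencil A z)].

End RealBessmertnyi.

Section Hilbert.
Context {R : realType}.
Local Notation C := R[i].

Definition dnorm (U : lmodType C) (dot : U -> U -> C) (x : U) : C :=
  sqrtC (dot x x).

Definition complete_for (U : lmodType C) (dot : U -> U -> C) :=
  forall u : nat -> U,
    (forall e : R, 0 < e -> exists N, forall i j, (N <= i)%N -> (N <= j)%N ->
       dnorm dot (u i - u j) < e%:C%C) ->
    exists l, forall e : R, 0 < e -> exists N, forall i, (N <= i)%N ->
       dnorm dot (u i - l) < e%:C%C.

Definition bounded_op (U : lmodType C) (dot : U -> U -> C) (T : U -> U) :=
  exists M : R, forall x, dnorm dot (T x) <= M%:C%C * dnorm dot x.

Definition psd_op (U : lmodType C) (dot : U -> U -> C) (T : U -> U) :=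
  forall x, 0 <= dot (T x) x.

Definition antiunitary_involution (U : lmodType C) (dot : U -> U -> C)
    (iota : U -> U) :=
  involutive iota /\ forall u v, dot (iota u) (iota v) = dot v u.

End Hilbert.

Record hilbertSpace (R : realType) := HilbertSpace {
  hcarrier :> lmodType R[i];
  hdot : {dot hcarrier for Num.conj};
  hcomplete : complete_for hdot
}.

Section RealBessmertnyiRat.
Context {R : realType} {d n : nat}.
Local Notation C := R[i].

Definition sum_dot (H : hilbertSpace R) (x y : ('cV[C]_n * H)%type) : C :=
  cdot x.1 y.1 + hdot H x.2 y.2.

Definition sum_conj (H : hilbertSpace R) (iota : H -> H)
    (x : ('cV[C]_n * H)%type) : ('cV[C]_n * H)%type :=
  (map_mx Num.conj x.1, iota x.2).

Section Blocks.
Variables (H : hilbertSpace R).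
Variable A : 'I_d -> {linear ('cV[C]_n * H)%type -> ('cV[C]_n * H)%type}.

Definition op_pencil (z : 'rV[C]_d) (x : ('cV[C]_n * H)%type) :
  ('cV[C]_n * H)%type := \sum_(j < d) z 0 j *: A j x.

Definition op11 z (u : 'cV[C]_n) : 'cV[C]_n := (op_pencil z (u, 0)).1.
Definition op12 z (h : H) : 'cV[C]_n := (op_pencil z (0, h)).1.
Definition op21 z (u : 'cV[C]_n) : H := (op_pencil z (u, 0)).2.
Definition op22 z (h : H) : H := (op_pencil z (0, h)).2.

End Blocks.

(* B is the bounded inverse of A22(z). *)
Definition RBrat_class (F : 'rV[C]_d -> 'M[C]_n) :=
  [/\ rational_on Omega F, holomorphic_on Omega F &
  exists (H : hilbertSpace R) (iota : H -> H)
    (A : 'I_d -> {linear ('cV[C]_n * H)%type -> ('cV[C]_n * H)%type}),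
    [/\ antiunitary_involution (hdot H) iota,
        forall j, bounded_op (@sum_dot H) (A j),
        forall j, psd_op (@sum_dot H) (A j),
        forall j x, sum_conj iota (A j x) = A j (sum_conj iota x) &
        forall z, Omega z -> exists B : {linear H -> H},
          [/\ bounded_op (hdot H) B, cancel (op22 A z) B, cancel B (op22 A z) &
              forall u, F z *m u = op11 A z u - op12 A z (B (op21 A z u))]]].

End RealBessmertnyiRat.

Section Cayley.
Context {R : realType} {d n : nat}.
Local Notation C := R[i].

Definition cayley_point (zeta : 'rV[C]_d) : 'rV[C]_d :=
  \row_k ((1 + zeta 0 k) / (1 - zeta 0 k)).

Definition double_cayley (f : 'rV[C]_d -> 'M[C]_n) (zeta : 'rV[C]_d) : 'M[C]_n :=
  (f (cayley_point zeta) - 1%:M) *m invmx (f (cayley_point zeta) + 1%:M).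

Definition diag_P (m_ : 'I_d -> nat) (zeta : 'rV[C]_d) :
  'M[C]_(\sum_k m_ k) := \mxdiag_k ((zeta 0 k)%:M : 'M[C]_(m_ k)).

Definition transfer_function m (U : 'M[R]_(m + n)) (P : 'M[C]_m) : 'M[C]_n :=
  let Uc := map_mx (real_complex R) U in
  drsubmx Uc + dlsubmx Uc *m invmx (1%:M - P *m ulsubmx Uc) *m P *m ursubmx Uc.

End Cayley.

(* Main.v *)
(** Every condition yields kernels Phi_k with f(z) = sum_k z_k Phi_k(w, z).
    On positive real points, write f_jj = p_j / q_j. Freezing all but one
    coordinate, differences of f are Bezoutians of p_j and q_j, so that
    q_j(x) Phi_k(y, x)_ij is a polynomial of bounded degree in each coordinate of
    x: the Cauchy-Schwarz inequality turns the vanishing of a quadratic form of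
    the kernel at the interpolation nodes into the interpolation identity.
    Hence the kernels are determined by finitely many points, and their Gram
    matrices at these points form a pencil of real positive semidefinite matrices.
    Compressing the common kernel away makes the lower right block invertible on
    the poly-halfplane, and the Schur complement of the pencil continues f.

    Conversely a pencil with A_k = S_k^T S_k gives phi_k(z) = S_k psi(z), where the
    columns of psi(z) solve A(z) psi(z) = (f(z), 0). The transfer matrix U is the
    reflection 1 - 2P in the range of the matrix with blocks -S and (1 0);
    conversely the -1 eigenspace of U provides the pencil. *)
Require Import Defs.
From HB Require Import structures.
From mathcomp Require Import all_boot all_order all_algebra.
From mathcomp Require Import sesquilinear spectral.
From mathcomp Require Import all_classical all_reals all_analysis.
From mathcomp Require Import complex.
From mathcomp Require Import -(notations) mpoly.
From mathcomp Require Import qpoly ring lra.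
Import Order.TTheory GRing.Theory Num.Theory.
Import numFieldNormedType.Exports.
Local Open Scope classical_set_scope.
Local Open Scope sesquilinear_scope.
Local Open Scope ring_scope.

Set Implicit Arguments.
Unset Strict Implicit.
Unset Printing Implicit Defensive.

(** * Rational functions on subsets of C^d *)

(** Positivity has to supply all the regularity: in the operator condition nothing is known about
    how the kernels depend on their arguments; only f is known to be rational. Differences of f
    along a coordinate line give the kernel of that coordinate off the diagonal and say nothing on
    it; there an inequality from positivity, whose sign flips across the diagonal, fixes the value.
    The other kernels enter only through a sum with positive weights, so nonnegative quadratic forms
    whose weighted sum vanishes must all vanish. This is why the argument lives at positive real
    points, in a box free of zeros of the denominators. Only diagonal entries of f are treated as
    fractions: Cauchy-Schwarz takes care of the off-diagonal entries of the kernels. From the box, a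
    polynomial identity and the holomorphy of f lead to the whole poly-halfplane. The other
    recurrent tool is accretivity: Re y^* A(z) y combines the forms y^* A_k y with positive weights,
    so a vector at which it is not positive is annihilated by every A_k. *)

Lemma near_eq_differentiable (K : numFieldType) (V W : normedModType K)
    (g h : V -> W) (z : V) :
  (\forall y \near z, g y = h y) -> differentiable g z -> differentiable h z.
Proof.
move=> gh dg; have [dc gE] := (diff_locallyP z g).1 dg.
have ghz : g z = h z by exact: nbhs_singleton gh.
have hE : h \o shift z = cst (h z) + 'd g z +o_ 0 id.
  apply/eqaddoP => e e0; have /eqaddoP /(_ e e0) := gE.
  apply: filter_app; have := gh; rewrite (near_shift 0 z) subr0.
  by apply: filterS => y /= gy; rewrite !fctE /= gy ghz.
by apply/diff_locallyP; rewrite (diff_unique dc hE).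
Qed.

(* Unifying the topology of 'rV[R[i]]_D with that of 'rV[K]_D requires K to be
   given explicitly. *)
Definition cdiff (K : numFieldType) D (g : 'rV[K]_D -> K) (z : 'rV[K]_D) :=
  differentiable (g : 'rV[K]_D -> K^o) z.

Section ComplexDifferentiability.
Context {K : numFieldType} {D : nat}.
Implicit Types (g h p q : 'rV[K]_D -> K) (z : 'rV[K]_D).

Lemma cdiff_cst c z : cdiff (fun=> c) z.
Proof. exact: differentiable_cst. Qed.

Lemma cdiff_coord k z : cdiff (fun y => y 0 k) z.
Proof. exact: differentiable_coord. Qed.

Lemma cdiffD g h z : cdiff g z -> cdiff h z -> cdiff (fun y => g y + h y) z.
Proof. exact: differentiableD. Qed.

Lemma cdiffM g h z : cdiff g z -> cdiff h z -> cdiff (fun y => g y * h y) z.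
Proof. exact: differentiableM. Qed.

Lemma cdiff_ratio p q g z :
  cdiff p z -> cdiff q z -> q z != 0 ->
  (forall y, q y != 0 -> g y = p y / q y) -> cdiff g z.
Proof.
move=> dp dq qz gE.
have dpq : differentiable ((fun z => p z * (q z)^-1) : 'rV[K]_D -> K^o) z.
  apply: (@differentiableM K _ p (fun z => (q z)^-1) z dp).
  exact: (@differentiableV K _ q z dq qz).
have cq : {for z, continuous (q : 'rV[K]_D -> K^o)}.
  exact: differentiable_continuous.
apply: near_eq_differentiable dpq.
have : \forall y \near z, q y != 0.
  apply: (cq (fun c => c != 0)); apply/nbhs_ballP.
  exists `|q z|; first by rewrite /= normr_gt0.
  move=> c; rewrite -ball_normE /= => qc; apply/eqP => c0.
  by move: qc; rewrite c0 subr0 ltxx.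
by apply: filterS => y /gE ->.
Qed.

End ComplexDifferentiability.

Section PolynomialFunctions.
Context {R : realType} {D : nat}.
Local Notation C := R[i].
Implicit Types (S : set 'rV[C]_D) (g h : 'rV[C]_D -> C).

Definition polyfun g :=
  (exists P : mpoly D C, forall z, g z = meval (z 0) P) /\
  forall z, @cdiff C D g z.

Lemma polyfun_cst c : polyfun (fun=> c).
Proof.
split; first by exists (mpolyC D c) => z; rewrite mevalC.
by move=> z; exact: cdiff_cst.
Qed.

Lemma polyfun_coord k : polyfun (fun z => z 0 k).
Proof.
split; first by exists (mpolyX C (mnm1 k)) => z; rewrite mevalXU.
by move=> z; exact: cdiff_coord.
Qed.

Lemma polyfunD g h : polyfun g -> polyfun h -> polyfun (fun z => g z + h z).
Proof.
move=> [[P gP] dg] [[Q hQ] dh]; split.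
  by exists (P + Q) => z; rewrite gP hQ mevalD.
by move=> z; exact: cdiffD.
Qed.

Lemma polyfunM g h : polyfun g -> polyfun h -> polyfun (fun z => g z * h z).
Proof.
move=> [[P gP] dg] [[Q hQ] dh]; split.
  by exists (P * Q) => z; rewrite gP hQ mevalM.
by move=> z; exact: cdiffM.
Qed.

Lemma eq_polyfun g h : g =1 h -> polyfun g -> polyfun h.
Proof. by move=> /funext ->. Qed.

Lemma polyfun_sum I (r : seq I) (P : pred I) (g : I -> 'rV[C]_D -> C) :
  (forall i, polyfun (g i)) -> polyfun (fun z => \sum_(i <- r | P i) g i z).
Proof.
move=> pg; elim: r => [|i r IH].
  by apply: eq_polyfun (polyfun_cst 0) => z; rewrite big_nil.
case Pi: (P i).
  by apply: eq_polyfun (polyfunD (pg i) IH) => z; rewrite big_cons Pi.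
by apply: eq_polyfun IH => z; rewrite big_cons Pi.
Qed.

Lemma polyfun_prod I (r : seq I) (P : pred I) (g : I -> 'rV[C]_D -> C) :
  (forall i, polyfun (g i)) -> polyfun (fun z => \prod_(i <- r | P i) g i z).
Proof.
move=> pg; elim: r => [|i r IH].
  by apply: eq_polyfun (polyfun_cst 1) => z; rewrite big_nil.
case Pi: (P i).
  by apply: eq_polyfun (polyfunM (pg i) IH) => z; rewrite big_cons Pi.
by apply: eq_polyfun IH => z; rewrite big_cons Pi.
Qed.

Lemma polyfun_det m (M : 'rV[C]_D -> 'M[C]_m) :
  (forall i j, polyfun (fun z => M z i j)) -> polyfun (fun z => \det (M z)).
Proof.
move=> pM; apply: polyfun_sum => s; apply: polyfunM; first exact: polyfun_cst.
exact: polyfun_prod.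
Qed.

Lemma polyfun_adj m (M : 'rV[C]_D -> 'M[C]_m) :
  (forall i j, polyfun (fun z => M z i j)) ->
  forall i j, polyfun (fun z => (\adj (M z)) i j).
Proof.
move=> pM i j.
apply: (@eq_polyfun (fun z => (-1) ^+ (j + i) * \det (row' j (col' i (M z))))).
  by move=> z; rewrite mxE.
apply: polyfunM; first exact: polyfun_cst.
apply: polyfun_det => a b.
by apply: (@eq_polyfun (fun z => M z (lift j a) (lift i b))) => // z; rewrite !mxE.
Qed.

(* The formula is required wherever q does not vanish, not only on S, so that
   g is p / q near every point of S even when S is not open. *)
Definition regfun S g := exists p q,
  [/\ polyfun p, polyfun q, forall z, S z -> q z != 0 &
      forall z, q z != 0 -> g z = p z / q z].

Lemma regfun_polyfun S g : polyfun g -> regfun S g.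
Proof.
move=> pg; exists g, (fun=> 1); split=> // [|z _].
  exact: polyfun_cst.
by rewrite divr1.
Qed.

Lemma eq_regfun S g h : g =1 h -> regfun S g -> regfun S h.
Proof. by move=> /funext ->. Qed.

Lemma regfunD S g h : regfun S g -> regfun S h -> regfun S (fun z => g z + h z).
Proof.
move=> [p [q [pp pq q0 gE]]] [p' [q' [pp' pq' q'0 hE]]].
exists (fun z => p z * q' z + p' z * q z), (fun z => q z * q' z); split.
- by apply: polyfunD; exact: polyfunM.
- exact: polyfunM.
- by move=> z Sz; rewrite mulf_neq0 ?q0 ?q'0.
- move=> z; rewrite mulf_eq0 negb_or => /andP[qz q'z].
  by rewrite gE// hE// addf_div.
Qed.

Lemma regfunM S g h : regfun S g -> regfun S h -> regfun S (fun z => g z * h z).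
Proof.
move=> [p [q [pp pq q0 gE]]] [p' [q' [pp' pq' q'0 hE]]].
exists (fun z => p z * p' z), (fun z => q z * q' z); split.
- exact: polyfunM.
- exact: polyfunM.
- by move=> z Sz; rewrite mulf_neq0 ?q0 ?q'0.
- move=> z; rewrite mulf_eq0 negb_or => /andP[qz q'z].
  by rewrite gE// hE// mulf_div.
Qed.

Lemma regfun_sum S I (r : seq I) (P : pred I) (g : I -> 'rV[C]_D -> C) :
  (forall i, regfun S (g i)) -> regfun S (fun z => \sum_(i <- r | P i) g i z).
Proof.
move=> pg; elim: r => [|i r IH].
  apply: eq_regfun (regfun_polyfun S (polyfun_cst 0)) => z.
  by rewrite big_nil.
case Pi: (P i).
  by apply: eq_regfun (regfunD (pg i) IH) => z; rewrite big_cons Pi.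
by apply: eq_regfun IH => z; rewrite big_cons Pi.
Qed.

Lemma regfun_mulmx S m p q (M : 'rV[C]_D -> 'M[C]_(m, p))
    (N : 'rV[C]_D -> 'M[C]_(p, q)) :
  (forall i j, regfun S (fun z => M z i j)) ->
  (forall i j, regfun S (fun z => N z i j)) ->
  forall i j, regfun S (fun z => (M z *m N z) i j).
Proof.
move=> rM rN i j; apply: (@eq_regfun _ (fun z => \sum_k M z i k * N z k j)).
  by move=> z; rewrite mxE.
by apply: regfun_sum => k; exact: regfunM.
Qed.

Lemma regfun_invmx S m (M : 'rV[C]_D -> 'M[C]_m) :
  (forall i j, polyfun (fun z => M z i j)) ->
  (forall z, S z -> \det (M z) != 0) ->
  forall i j, regfun S (fun z => invmx (M z) i j).
Proof.
move=> pM M0 i j; exists (fun z => (\adj (M z)) i j), (fun z => \det (M z)).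
split=> //; [exact: polyfun_adj | exact: polyfun_det |].
by move=> z dz; rewrite /invmx unitmxE unitfE dz mxE mulrC.
Qed.

Lemma regfun_rational S g : S !=set0 -> regfun S g ->
  exists P Q : mpoly D C, Q != 0 /\
    forall z : 'rV[C]_D, meval (z 0) Q != 0 ->
      g z = meval (z 0) P / meval (z 0) Q.
Proof.
move=> [z0 Sz0] [p [q [[[P pP] _] [[Q qQ] _] q0 gE]]]; exists P, Q; split.
  by apply/eqP => Q0; have := q0 _ Sz0; rewrite qQ Q0 meval0 eqxx.
by move=> z; rewrite -pP -qQ => /gE.
Qed.

Lemma regfun_differentiable S g : regfun S g ->
  forall z, S z -> @cdiff C D g z.
Proof.
move=> [p [q [[_ dp] [_ dq] q0 gE]]] z Sz.
exact: (@cdiff_ratio C _ _ _ _ _ (dp z) (dq z) (q0 z Sz) gE).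
Qed.

End PolynomialFunctions.

(** * Points where a polynomial does not vanish, and continuation from them *)

Section NonVanishing.
Context {K : fieldType}.

Local Notation wid := (widen_ord (leqnSn _)).

Definition mnm_init n (m : multinom n.+1) : multinom n :=
  Multinom [tuple m (wid i) | i < n].

(** [muni] reads a polynomial as univariate in its last variable. Every coefficient of P reappears
    in it, so a nonzero P has a nonzero [muni P]. *)
Lemma mcoeff_muni n (P : mpoly n.+1 K) m :
  mcoeff (mnm_init m) (muni P)`_(m ord_max) = mcoeff m P.
Proof.
rewrite muniE coef_sum raddf_sum /= [in RHS](mpolyE P) raddf_sum /=.
apply: eq_bigr => m' _; rewrite coefZ coefXn mulr_natr raddfMn /= !mcoeffZ.
rewrite !mcoeffX.
rewrite -mulrnAr -mulrnA mulnb; congr (_ * (nat_of_bool _)%:R).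
apply/idP/idP => [/andP[/eqP mm' /eqP mx]|/eqP ->]; last by rewrite !eqxx.
apply/eqP/mnmP => i; case: (unliftP ord_max i) => [j|] -> //.
move/mnmP/(_ j): mm'; rewrite !mnmE.
suff -> : wid j = lift ord_max j by [].
by apply/val_inj; rewrite /= /bump leqNgt ltn_ord.
Qed.

Lemma meval_muni n (P : mpoly n.+1 K) (v : 'I_n.+1 -> K) :
  (map_poly (meval (fun i => v (widen_ord (leqnSn n) i))) (muni P)).[v ord_max]
  = meval v P.
Proof.
rewrite muniE rmorph_sum horner_sum mevalE; apply: eq_bigr => m _ /=.
rewrite map_polyZ map_polyXn hornerZ hornerXn /= mevalZ mevalX -mulrA.
rewrite big_ord_recr /=; congr (_ * (_ * _)).
by apply: eq_bigr => i _; rewrite mnmE.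
Qed.

(** Induction on the number of variables: first a point where the leading coefficient in the last
    variable survives, then a value of that variable. The sets [S i] need only escape the roots of
    univariate polynomials, which admits both real boxes and arbitrarily small shifts of a given
    point. *)
Lemma mpoly_neq0_point n (P : mpoly n K) (S : 'I_n -> K -> Prop) :
  (forall i (p : {poly K}), p != 0 -> exists x, S i x /\ p.[x] != 0) ->
  P != 0 -> exists v, (forall i, S i (v i)) /\ meval v P != 0.
Proof.
elim: n P S => [|n IH] P S Sd P0.
  exists (fun=> 0); split; first by case.
  apply: contraNneq P0 => P0; apply/eqP.
  suff -> : P = mpolyC 0 (meval (fun=> 0) P) by rewrite P0 mpolyC0.
  rewrite mevalE {1}(mpolyE P) raddf_sum /=; apply: eq_bigr => m _.
  rewrite big_ord0 mulr1 (_ : m = @mnm0 0) ?mpolyX0 ?alg_mpolyC //.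
  by apply/mnmP; case.
have uP0 : muni P!= 0.
  apply: contraNneq P0 => uP; apply/eqP/mpolyP => m; rewrite mcoeff0.
  by rewrite -mcoeff_muni uP coef0 mcoeff0.
have lP0 : lead_coef (muni P) != 0 by rewrite lead_coef_eq0.
have [v' [Sv' c0]] := IH _ (fun i => S (wid i)) (fun i => Sd _) lP0.
have q0 : map_poly (meval v') (muni P) != 0.
  apply: contraNneq c0 => q0; rewrite lead_coefE -coef_map /=.
  by rewrite q0 coef0.
have [x [Sx qx]] := Sd ord_max _ q0.
pose v i := oapp v' x (unlift ord_max i).
have widE i : wid i = lift ord_max i.
  by apply/val_inj; rewrite /= /bump leqNgt ltn_ord.
have vw i : v (wid i) = v' i by rewrite widE /v liftK.
have vm : v ord_max = x by rewrite /v unlift_none.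
exists v; split; last first.
  by rewrite -meval_muni vm (@eq_map_poly _ _ _ (meval v'))// => p; apply: meval_eq.
by move=> i; case: (unliftP ord_max i) => [j|] ->; rewrite -?widE ?vw ?vm.
Qed.

End NonVanishing.

Lemma cdiff_eq0 (K : numFieldType) D (g : 'rV[K]_D -> K) (z : 'rV[K]_D) :
  cdiff g z ->
  (forall e, 0 < e -> exists y : 'rV[K]_D,
     (forall j, `|z 0 j - y 0 j| < e) /\ g y = 0) ->
  g z = 0.
Proof.
move=> dg zg; apply/eqP/negP => /negP gz.
have cg : {for z, continuous (g : 'rV[K]_D -> K^o)}.
  exact: differentiable_continuous.
have : \forall y \near z, g y != 0.
  apply: (cg (fun c => c != 0)); apply/nbhs_ballP.
  exists `|g z|; first by rewrite /= normr_gt0.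
  move=> c; rewrite -ball_normE /= => qc; apply/eqP => c0.
  by move: qc; rewrite c0 subr0 ltxx.
move/nbhs_ballP => [e /= e0 eg]; have [y [zy gy]] := zg e e0.
have /eg : ball z e y by split=> // i j; rewrite ord1 -ball_normE; exact: zy.
by rewrite gy eqxx.
Qed.

Section Density.
Context {R : realType}.
Local Notation C := R[i].

Lemma near_nonroot (p : {poly C}) (a : C) (e : R) : p != 0 -> 0 < e ->
  exists t : R, 0 < t < e /\ p.[a + t%:C%C] != 0.
Proof.
move=> p0 e0; pose t k : R := e / k.+2%:R.
have ti : injective t.
  move=> i j /(mulfI (lt0r_neq0 e0))/invr_inj/eqP; rewrite eqr_nat => /eqP.
  by move=> [].
(* These are [size p] distinct points, more than p can have roots; [k.+2] keeps every shift strictly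
   below e. *)
pose s := [seq a + (t k)%:C%C | k <- iota 0 (size p)].
have us : uniq s.
  rewrite map_inj_uniq ?iota_uniq // => i j /addrI/complexI; exact: ti.
have : ~~ all (root p) s.
  apply/negP => /(max_poly_roots p0)/(_ us).
  by rewrite size_map size_iota ltnn.
case/allPn => _ /mapP[k _ ->] pk; exists (t k); split => //.
by rewrite divr_gt0 ?ltr0n //= ltr_pdivrMr ?ltr0n // ltr_pMr // ltr1n.
Qed.

(** Adding small positive reals to the coordinates stays in the poly-halfplane and reaches points
    where Q does not vanish, arbitrarily close to z; continuity at z does the rest. *)
Lemma halfplane_continuation D (g : 'rV[C]_D -> C) (Q : mpoly D C) :
  Q != 0 ->
  (forall z : 'rV[C]_D, polyhalfplane z -> meval (z 0) Q != 0 -> g z = 0) ->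
  forall z, polyhalfplane z -> @cdiff C D g z -> g z = 0.
Proof.
move=> Q0 gQ z zP /(@cdiff_eq0 C); apply=> e e0.
have [x ex] : exists x : R, x%:C%C = e.
  by exists (complex.Re e); rewrite RRe_real // gtr0_real.
have x0 : 0 < x by rewrite -ltcR ex.
pose S i c := exists t : R, 0 < t < x /\ c = z 0 i + t%:C%C.
have [|v [Sv Qv]] := @mpoly_neq0_point _ _ Q S _ Q0.
  move=> i p p0; have [t [tx pt]] := near_nonroot (z 0 i) p0 x0.
  by exists (z 0 i + t%:C%C); split => //; exists t.
exists (\row_j v j); split.
  move=> j; rewrite mxE; have [t [/andP[t0 tx] ->]] := Sv j.
  by rewrite opprD addNKr normrN -ex normc_def /= expr0n addr0 sqrtr_sqr ltcR gtr0_norm.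
apply: gQ.
  move=> j; rewrite mxE; have [t [/andP[t0 tx] ->]] := Sv j.
  by rewrite raddfD /= addr_gt0 // zP.
rewrite (@meval_eq _ _ _ v) // => j; by rewrite mxE.
Qed.

End Density.

(** * Interpolation of positive kernels on a line *)

Section RealKernels.
Context {R : realType} {T : Type}.
Implicit Types (K : T -> T -> R) (B : T -> Prop).

(** Families are indexed by any [finType], so that a point can be adjoined to a family through a sum
    type. *)
Definition real_kernel B K :=
  (forall a b, B a -> B b -> K a b = K b a) /\
  forall (I : finType) (t : I -> T) (c : I -> R), (forall i, B (t i)) ->
    0 <= \sum_i \sum_j c i * c j * K (t i) (t j).

(** The Cauchy-Schwarz argument: adjoining b with coefficient e to the null family leaves e^2 K(b,
    b) + 2 e v, which stays nonnegative for all e only if v = 0. *)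
Lemma real_kernel_null B K (I : finType) (t : I -> T) (c : I -> R) b :
  real_kernel B K -> (forall i, B (t i)) -> B b ->
  \sum_i \sum_j c i * c j * K (t i) (t j) = 0 ->
  \sum_i c i * K b (t i) = 0.
Proof.
move=> [Ksym Kpsd] Bt Bb Q0; set v := \sum_i _.
have Qe (e : R) : 0 <= e ^+ 2 * K b b + 2 * (e * v).
  pose t' (i : 'I_1 + I) := if i is inr i then t i else b.
  pose c' (i : 'I_1 + I) := if i is inr i then c i else e.
  have Bo i : B (t' i) by case: i.
  have := Kpsd _ t' c' Bo; rewrite big_sumType big_ord1 /=.
  rewrite big_sumType big_ord1 /=.
  under [X in 0 <= _ + X]eq_bigr do rewrite big_sumType big_ord1 /=.
  rewrite big_split /= Q0 addr0.
  rewrite [X in _ + X](_ : _ = e * v); last first.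
    rewrite mulr_sumr; apply: eq_bigr => i _.
    by rewrite (Ksym (t i)) // mulrCA mulrA.
  rewrite [X in _ + X + _](_ : _ = e * v); last first.
    by rewrite mulr_sumr; apply: eq_bigr => i _; rewrite mulrA.
  by rewrite -addrA -mulr2n [2 * _]mulr_natl expr2.
have Kb : 0 <= K b b.
  by have := Kpsd 'I_1 (fun=> b) (fun=> 1) (fun=> Bb); rewrite !big_ord1 /= !mul1r.
apply/eqP; rewrite -sqrf_eq0; apply/eqP.
(* The denominator is positive even if [K b b] vanishes, and the quadratic becomes a negative
   multiple of v^2. *)
have := Qe (- v / (K b b + 1)).
have -> : (- v / (K b b + 1)) ^+ 2 * K b b + 2 * (- v / (K b b + 1) * v) =
   - (v ^+ 2 * ((K b b + 2) / (K b b + 1) ^+ 2)).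
  by field; lra.
rewrite oppr_ge0 pmulr_lle0; last by rewrite divr_gt0 ?exprn_gt0; lra.
by move=> v0; apply/le_anti; rewrite v0 sqr_ge0.
Qed.

End RealKernels.

Lemma poly_sign_change {R : realType} (v : {poly R}) (a b t : R) :
  a < t < b ->
  (forall s, t < s < b -> 0 <= v.[s]) -> (forall s, a < s < t -> v.[s] <= 0) ->
  v.[t] = 0.
Proof.
move=> /andP[at_ tb] vp vn; apply: contrapT => /eqP vt.
have vt0 : 0 < `|v.[t]| by rewrite normr_gt0.
have [e e0 ve] := polyrcf.poly_cont t v vt0.
pose m := Num.min e (Num.min (t - a) (b - t)).
have m0 : 0 < m by rewrite !lt_min e0 !subr_gt0 at_ tb.
pose h := m / 2; have h0 : 0 < h by rewrite /h; lra.
have : h < m by rewrite /h; lra.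
rewrite !lt_min => /and3P[he ha hb].
have v1 : 0 <= v.[t + h] by apply: vp; lra.
have v2 : v.[t - h] <= 0 by apply: vn; lra.
have := ve (t + h); have := ve (t - h).
rewrite addrAC subrr add0r normrN [t + h - t]addrAC subrr add0r gtr0_norm //.
move=> /(_ he) + /(_ he); rewrite !ltr_norml => /andP[l1 u1] /andP[l2 u2].
by case: (ltrgt0P v.[t]) vt l1 u1 l2 u2 => // sgn _ l1 u1 l2 u2; lra.
Qed.

(** The combination q(t) p - p(t) q vanishes at t; its quotient by X - t is the Bezoutian of p and q
    with one argument frozen. *)
Lemma bezoutian_kernel {R : realType} (p q : {poly R}) (t : R) (m : nat) :
  (size p <= m)%N -> (size q <= m)%N ->
  exists r : {poly R}, (size r < m.+1)%N /\
    forall s, p.[s] * q.[t] - p.[t] * q.[s] = (s - t) * r.[s].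
Proof.
move=> sp sq; pose u := q.[t] *: p - p.[t] *: q.
have /factor_theorem[r ur] : root u t.
  by rewrite /root hornerD hornerN !hornerZ mulrC subrr.
have su : (size u <= m)%N.
  rewrite (leq_trans (size_polyD _ _)) // geq_max size_polyN.
  by rewrite !(leq_trans (size_scale_leq _ _)).
exists r; split.
  have [->|r0] := eqVneq r 0; first by rewrite size_poly0.
  rewrite ltnS; move: su.
  by rewrite ur size_Mmonic ?monicXsubC // size_XsubC addn2 /=; exact: ltnW.
move=> s; have := congr1 (horner^~ s) ur.
rewrite /= hornerM hornerXsubC hornerD hornerN !hornerZ => E.
by rewrite mulrC [in RHS]mulrC -E mulrC.
Qed.

Section LineInterpolation.
Context {R : realType} {d : nat}.
Variables (a b : R) (l : 'I_d) (x : 'I_d -> R) (k_ : 'I_d -> R -> R -> R).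
Variables (phi : R -> R) (p q : {poly R}) (m : nat) (node : nat -> R).

Local Notation S s := (a < s < b).
Local Notation w k s := (if k == l then s else x k).

Hypothesis x_gt0 : forall k, k != l -> 0 < x k.
Hypothesis a_ge0 : 0 <= a.
Hypothesis k_ker : forall k, real_kernel (fun s => S s) (k_ k).
Hypothesis k_sum : forall s t, S s -> S t -> \sum_k w k s * k_ k t s = phi s.
Hypothesis phi_ratio : forall s, S s -> phi s * q.[s] = p.[s].
Hypothesis q_gt0 : forall s, S s -> 0 < q.[s].
Hypotheses (sp : (size p <= m)%N) (sq : (size q <= m)%N).
Hypothesis node_inj : injective node.
Hypothesis nodeS : forall i, S (node i).

Let k_sym k s t : S s -> S t -> k_ k s t = k_ k t s.
Proof. by move=> Ss St; apply: (k_ker k).1. Qed.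

Let w_gt0 k s : S s -> 0 < w k s.
Proof.
by case/andP=> as_ _; case: eqVneq => [_|]; [apply: le_lt_trans as_|exact: x_gt0].
Qed.

Let w_diff (g : 'I_d -> R) s t :
  \sum_k w k s * g k = \sum_k w k t * g k + (s - t) * g l.
Proof.
have E r : \sum_(k < d | k != l) w k r * g k = \sum_(k < d | k != l) x k * g k.
  by apply: eq_bigr => k /negPf ->.
rewrite (bigD1 l) //= [in RHS](bigD1 l) //= !E eqxx; ring.
Qed.

(** In [k_sum] the value phi(s) does not depend on the first kernel argument t. Replacing the
    weights of s by those of t changes only the l-th term, and by symmetry what remains is
    phi(t). *)
Let diff_l s t : S s -> S t -> phi s - phi t = (s - t) * k_ l t s.
Proof.
move=> Ss St; rewrite -(k_sum Ss St) (w_diff _ _ t) -(k_sum St Ss).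
rewrite [X in _ - X](eq_bigr (fun k => w k t * k_ k t s)); first by ring.
by move=> k _; rewrite k_sym.
Qed.

(** This is the only hold on [k_ l t t], since [diff_l] is void for s = t. The coefficients 1 and -1
    at s and t make every kernel contribute a nonnegative term, and the sum with the weights of s
    collapses to this inequality. *)
Let diff_diag s t : S s -> S t -> phi s - phi t <= (s - t) * k_ l t t.
Proof.
move=> Ss St.
suff : 0 <= \sum_k w k s * (k_ k s s - 2 * k_ k t s + k_ k t t).
  under eq_bigr do rewrite mulrDr mulrBr mulrCA.
  rewrite big_split /= sumrB -mulr_sumr !k_sum // (w_diff _ _ t) k_sum //; lra.
apply: sumr_ge0 => k _; apply: mulr_ge0; first exact/ltW/w_gt0.
have := (k_ker k).2 bool (fun c => if c then s else t) (fun c => if c then 1 else -1).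
have Sc (c : bool) : S (if c then s else t) by case: c.
move/(_ Sc); rewrite !big_bool /= !mulr1 !mul1r !mulN1r opprK (k_sym _ Ss St); lra.
Qed.

(** For s different from t, [diff_l] identifies the kernel with the Bezoutian divided by q(s) q(t).
    The diagonal value has to be matched separately, as no continuity of the kernel is available. *)
Lemma line_poly t : S t -> exists r : {poly R}, (size r < m.+1)%N /\
  forall s, S s -> q.[s] * k_ l t s = r.[s].
Proof.
move=> St; have qt := q_gt0 St.
have [r [sr rE]] := bezoutian_kernel t sp sq.
have rphi s : S s -> (s - t) * r.[s] = q.[s] * q.[t] * (phi s - phi t).
  by move=> Ss; rewrite -rE -!phi_ratio //; ring.
(* By [diff_diag] the product (s - t) v(s) is nonnegative, so v changes sign at t and vanishes
   there; v(t) = 0 is the missing diagonal identity. *)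
pose v := (k_ l t t * q.[t]) *: q - r.
have vE s : (s - t) * v.[s] =
    (s - t) * (k_ l t t * q.[t] * q.[s]) - (s - t) * r.[s].
  by rewrite hornerD hornerN hornerZ mulrBr.
have vge s : S s -> 0 <= (s - t) * v.[s].
  move=> Ss; rewrite vE rphi //; have := diff_diag Ss St.
  have := mulr_gt0 (q_gt0 Ss) qt; set Q := _ * q.[t] => Q0 D.
  have -> : (s - t) * (k_ l t t * q.[t] * q.[s]) - Q * (phi s - phi t) =
    Q * ((s - t) * k_ l t t - (phi s - phi t)) by rewrite /Q; ring.
  by apply: mulr_ge0; [exact: ltW | rewrite subr_ge0].
have vt : v.[t] = 0.
  have /andP[at_ tb] := St.
  apply: (poly_sign_change St) => s /andP[s1 s2].
    have /vge : S s by rewrite s2 (lt_trans at_).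
    by rewrite pmulr_rge0 ?subr_gt0.
  have /vge : S s by rewrite s1 (lt_trans s2).
  by rewrite nmulr_rge0 ?subr_lt0.
exists (q.[t]^-1 *: r); split.
  by rewrite (leq_ltn_trans (size_scale_leq _ _)).
move=> s Ss; rewrite hornerZ; apply: (mulfI (lt0r_neq0 qt)).
rewrite mulrA mulVKf ?lt0r_neq0 //; have [->|st] := eqVneq s t.
  by move: vt; rewrite hornerD hornerN hornerZ => /subr0_eq <-; ring.
apply: (mulfI (_ : s - t != 0)); first by rewrite subr_eq0.
by rewrite rphi // diff_l //; ring.
Qed.

Let L i := tnth (lagrange m.+1 node) i.

Definition interp_pt s (o : 'I_1 + 'I_m.+1) := if o is inr i then node i else s.

(** The coefficients of the interpolation error of q g at s, as a functional of g: q(s) g(s) minus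
    the Lagrange interpolant of q g through the nodes. *)
Definition interp_cf s (o : 'I_1 + 'I_m.+1) :=
  if o is inr i then - ((L i).[s] * q.[node i]) else q.[s].

Let cf_poly (g : R -> R) (r : {poly R}) s : S s -> (size r <= m.+1)%N ->
  (forall s, S s -> q.[s] * g s = r.[s]) ->
  \sum_o interp_cf s o * g (interp_pt s o) = 0.
Proof.
move=> Ss sr gr; rewrite big_sumType big_ord1 /= gr //.
rewrite {1}(lagrange_gen (ltn0Sn m) node_inj sr) horner_sum -big_split /=.
rewrite big1 // => i _; rewrite hornerM hornerC -gr // /L; ring.
Qed.

(** The error functional kills the l-th kernel by [line_poly]. Of the others only the combination
    with weights x_j is known to become polynomial; it is killed too, and since its quadratic form
    is a sum of nonnegative terms with positive weights, each term is zero. *)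
Lemma line_null s k : S s ->
  \sum_o \sum_o' interp_cf s o * interp_cf s o' *
    k_ k (interp_pt s o) (interp_pt s o') = 0.
Proof.
move=> Ss; have Spt o : S (interp_pt s o) by case: o => [_|i] /=.
pose E k t := \sum_o interp_cf s o * k_ k t (interp_pt s o).
pose Q k := \sum_o interp_cf s o * E k (interp_pt s o).
have QE j : \sum_o \sum_o' interp_cf s o * interp_cf s o' *
    k_ j (interp_pt s o) (interp_pt s o') = Q j.
  apply: eq_bigr => o _; rewrite mulr_sumr; apply: eq_bigr => o' _.
  by rewrite mulrA.
have Q0 j : 0 <= Q j by rewrite -QE; apply: (k_ker j).2.
have El t : S t -> E l t = 0.
  by move=> St; have [r [sr rE]] := line_poly St; exact: (cf_poly Ss (ltnW sr)).
have Er t : S t -> \sum_(j | j != l) x j * E j t = 0.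
  move=> St; have [r [sr rE]] := line_poly St.
  rewrite /E; under eq_bigr do rewrite mulr_sumr.
  rewrite exchange_big /=.
  under eq_bigr => o _ do under eq_bigr => j _ do rewrite mulrCA.
  under eq_bigr => o _ do rewrite -mulr_sumr.
  (* What the l-th term leaves of phi, multiplied by q, is p - X r. The factor X raises the size by
     one, hence [m.+1] nodes. *)
  apply: (@cf_poly (fun u => \sum_(j | j != l) x j * k_ j t u) (p - 'X * r)) => //.
    rewrite (leq_trans (size_polyD _ _)) // geq_max size_polyN (leqW sp) /=.
    have [->|r0] := eqVneq r 0; first by rewrite mulr0 size_poly0.
    by rewrite mulrC size_mulX.
  move=> u Su; rewrite hornerD hornerN hornerM hornerX -phi_ratio // -rE //.
  rewrite -(k_sum Su St) [in RHS](bigD1 l) //= eqxx.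
  rewrite [\sum_(i | i != l) _ in RHS](eq_bigr (fun j => x j * k_ j t u)).
    by ring.
  by move=> j /negPf ->.
rewrite QE; have [->|kl] := eqVneq k l.
  by rewrite /Q big1 // => o _; rewrite El ?mulr0.
have : \sum_(j | j != l) x j * Q j = 0.
  rewrite /Q; under eq_bigr do rewrite mulr_sumr.
  rewrite exchange_big big1 //= => o _.
  under eq_bigr do rewrite mulrCA.
  by rewrite -mulr_sumr Er ?mulr0.
move/psumr_eq0P => /(_ _ k kl) /eqP; rewrite mulf_eq0 gt_eqF ?x_gt0 //= => h.
by apply/eqP; apply: h => j jl; rewrite mulr_ge0 // ltW // x_gt0.
Qed.

End LineInterpolation.

(** * Finite-dimensional realization over a box *)

Section BoxInterpolation.
Context {R : realType} {d n : nat}.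
Variables (a b : 'I_d -> R) (m : nat).
Hypothesis a_ge0 : forall l, 0 <= a l.
Hypothesis ab : forall l, a l < b l.

Local Notation S l s := (a l < s < b l).

Definition in_box (x : 'rV[R]_d) := forall l, S l (x 0 l).

Definition upd (x : 'rV[R]_d) l s : 'rV[R]_d :=
  \row_k (if k == l then s else x 0 k).

Definition node l k : R := a l + (b l - a l) / k.+2%:R.

Lemma node_inj l : injective (node l).
Proof.
move=> i j /addrI/mulfI; rewrite subr_eq0 gt_eqF // => /(_ isT)/invr_inj/eqP.
by rewrite eqr_nat => /eqP [].
Qed.

Lemma nodeS l k : S l (node l k).
Proof.
have ba : 0 < b l - a l by rewrite subr_gt0.
rewrite /node ltrDl divr_gt0 ?ltr0n //= -ltrBrDl.
by rewrite ltr_pdivrMr ?ltr0n // ltr_pMr // ltr1n.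
Qed.

Lemma upd_box x l s : in_box x -> S l s -> in_box (upd x l s).
Proof. by move=> Bx Ss k; rewrite mxE; case: eqP => [->|]. Qed.

Lemma upd_id x l : upd x l (x 0 l) = x.
Proof. by apply/rowP => k; rewrite mxE; case: eqP => [->|]. Qed.

Definition node_lagrange l (i : 'I_m.+1) := tnth (lagrange m.+1 (node l)) i.

Definition interpolable (g : 'rV[R]_d -> R) := forall x l s, in_box x -> S l s ->
  g (upd x l s) =
  \sum_(i < m.+1) (node_lagrange l i).[s] * g (upd x l (node l i)).

Definition separately_poly (k : nat) (g : 'rV[R]_d -> R) := forall x l,
  exists r : {poly R}, (size r <= k)%N /\ forall s, g (upd x l s) = r.[s].

Lemma separately_poly_interpolable g :
  separately_poly m.+1 g -> interpolable g.
Proof.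
move=> gp x l s Bx Ss; have [r [sr rE]] := gp x l.
rewrite rE {1}(lagrange_gen (ltn0Sn m) (@node_inj l) sr) horner_sum.
by apply: eq_bigr => i _; rewrite hornerM hornerC -rE mulrC.
Qed.

(** Tensor-product Lagrange interpolation, one coordinate at a time. The grid and the weights do not
    depend on g, so that one grid serves all kernels, all test points and the denominators. *)
Lemma interpolation_grid : exists (I : finType) (xi : I -> 'rV[R]_d)
    (cf : I -> 'rV[R]_d -> R), (forall i, in_box (xi i)) /\
  forall g, interpolable g -> forall x, in_box x ->
    g x = \sum_i cf i x * g (xi i).
Proof.
(* The coordinates in [ls] have already been moved to the grid point y; the others still belong to
   x. *)
pose over ls (y x : 'rV[R]_d) : 'rV[R]_d :=
  \row_k (if k \in (ls : seq 'I_d) then y 0 k else x 0 k).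
suff /(_ (enum 'I_d)) [I [xi [cf [xiB cfE]]]] : forall ls,
    exists (I : finType) (xi : I -> 'rV[R]_d) (cf : I -> 'rV[R]_d -> R),
    (forall i, in_box (xi i)) /\
    forall g, interpolable g -> forall x, in_box x ->
      g x = \sum_i cf i x * g (over ls (xi i) x).
  exists I, xi, cf; split => // g gi x Bx; rewrite (cfE g gi x Bx).
  apply: eq_bigr => i _; congr (_ * g _).
  by apply/rowP => k; rewrite mxE mem_enum.
elim=> [|l ls [I [xi [cf [xiB cfE]]]]].
  exists 'I_1, (fun=> \row_k node k 0), (fun _ _ => 1); split=> [_ k|g _ x _].
    by rewrite mxE; exact: nodeS.
  by rewrite big_ord1 mul1r; congr g; apply/rowP => k; rewrite mxE.
exists (I * 'I_m.+1)%type, (fun o : I * 'I_m.+1 => upd (xi o.1) l (node l o.2)).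
exists (fun (o : I * 'I_m.+1) x =>
  cf o.1 x * (node_lagrange l o.2).[over ls (xi o.1) x 0 l]).
split=> [v|g gi x Bx]; first by apply: upd_box => //; exact: nodeS.
rewrite (cfE g gi x Bx) -(pair_bigA _ (fun i j =>
  cf i x * (node_lagrange l j).[over ls (xi i) x 0 l] *
  g (over (l :: ls) (upd (xi i) l (node l j)) x))) /=.
apply: eq_bigr => i _; set y := over _ _ _.
have By : in_box y by move=> k; rewrite mxE; case: ifP => _; [exact: xiB|exact: Bx].
rewrite -[in LHS](upd_id y l) gi // mulr_sumr; apply: eq_bigr => j _.
rewrite mulrA; congr (_ * g _); apply/rowP => k.
by rewrite !mxE inE; case: eqP => [->|] //=.
Qed.

Section KernelRealization.
Variables (k_ : 'I_d -> 'rV[R]_d * 'I_n -> 'rV[R]_d * 'I_n -> R).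
Variables (f : 'rV[R]_d -> 'M[R]_n) (p q : 'I_n -> 'rV[R]_d -> R).

Hypothesis k_ker : forall k, real_kernel (fun t => in_box t.1) (k_ k).
Hypothesis k_sum : forall x y i j, in_box x -> in_box y ->
  \sum_k x 0 k * k_ k (y, i) (x, j) = f x i j.
Hypothesis f_ratio : forall x j, in_box x -> f x j j * q j x = p j x.
Hypothesis q_gt0 : forall x j, in_box x -> 0 < q j x.
Hypothesis p_poly : forall j, separately_poly m (p j).
Hypothesis q_poly : forall j, separately_poly m (q j).

(** On the line through x in direction l and for the component j, the interpolation error has norm
    zero in every kernel. By Cauchy-Schwarz it then pairs to zero with any point t of the box and
    any component, on that line or not. *)
Lemma kernel_interpolable k t j : in_box t.1 ->
  interpolable (fun x => q j x * k_ k t (x, j)).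
Proof.
move=> Bt x l s Bx Ss.
have [rp [sp pE]] := p_poly j x l; have [rq [sq qE]] := q_poly j x l.
pose X s := (upd x l s, j).
have BX u : S l u -> in_box (X u).1 by move=> Su; exact: upd_box.
have kX k' : real_kernel (fun u => S l u) (fun u v => k_ k' (X u) (X v)).
  have [ksym kpsd] := k_ker k'; split=> [u v Su Sv|I u c Su].
    by apply: ksym; exact: BX.
  by apply: (kpsd I (X \o u)) => i; exact: BX.
have sumX u v : S l u -> S l v ->
    \sum_k' (if k' == l then u else x 0 k') * k_ k' (X v) (X u)
    = f (upd x l u) j j.
  move=> Su Sv; rewrite -(@k_sum _ (upd x l v)); [|exact: BX..].
  by apply: eq_bigr => k' _; rewrite mxE.
have ratioX u : S l u -> f (upd x l u) j j * rq.[u] = rp.[u].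
  by move=> Su; rewrite -pE -qE f_ratio //; exact: BX.
have qX u : S l u -> 0 < rq.[u] by move=> Su; rewrite -qE q_gt0 //; exact: BX.
have x0 k' : k' != l -> 0 < x 0 k'.
  by move=> _; have /andP[+ _] := Bx k'; exact: le_lt_trans.
have Bpt (v : 'I_1 + 'I_m.+1) : in_box (X (interp_pt (node l) s v)).1.
  by apply: BX; case: v => [_|i] //=; exact: nodeS.
have := real_kernel_null (k_ker k) Bpt Bt
  (line_null x0 (a_ge0 l) kX sumX ratioX qX sp sq (@node_inj l) (nodeS l) k Ss).
rewrite big_sumType big_ord1 /= -qE => /eqP; rewrite addr_eq0 => /eqP ->.
rewrite -sumrN; apply: eq_bigr => i _.
by rewrite mulNr opprK qE mulrA.
Qed.

(** With J repeating the n x n identity once per grid point, the Gram matrices satisfy (sum_k x_k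
    G_k) Y(x) = J f(x) and J^T Y(x) = 1. A congruence adapted to J puts this in block form. *)
Lemma kernel_realization : exists N (A : 'I_d -> 'M[R]_(n + N)),
  (forall k, real_psd_mx (A k)) /\
  forall x, in_box x -> exists Y : 'M[R]_(N, n),
    (\sum_k x 0 k *: A k) *m col_mx 1%:M Y = col_mx (f x) 0.
Proof.
have [I [xi [cf [xiB cfE]]]] := interpolation_grid.
pose x0 : 'rV[R]_d := \row_l node l 0.
have Bx0 : in_box x0 by move=> l; rewrite mxE; exact: nodeS.
(* The grid is nonempty because it reproduces the constant function 1; J needs one grid point to
   have a left inverse. *)
have [i0] : exists i : I, true.
  have one_int : interpolable (fun=> 1).
    apply: separately_poly_interpolable => x l; exists 1.
    by rewrite size_poly1; split=> // s; rewrite hornerC.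
  have := cfE _ one_int x0 Bx0; case: (pickP I) => [i|I0]; first by exists i.
  by rewrite big_pred0 // => /eqP; rewrite oner_eq0.
have q_int j : interpolable (q j).
  apply: separately_poly_interpolable => x l; have [r [sr rE]] := q_poly j x l.
  by exists r; split=> //; exact: leqW.
pose N := #|{: I * 'I_n}|.
pose pt (u : I * 'I_n) := (xi u.1, u.2).
have Bpt u : in_box (pt u).1 by exact: xiB.
pose G k : 'M[R]_N := \matrix_(u, v) k_ k (pt (enum_val u)) (pt (enum_val v)).
pose J : 'M[R]_(N, n) := \matrix_(u, i) ((enum_val u).2 == i)%:R.
pose X0 : 'M[R]_(n, N) := \matrix_(i, u) (enum_val u == (i0, i))%:R.
(* Column j uses only the component j of each grid point. The factors q_j enter because it is q_j
   times the kernel that is interpolated. *)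
pose Y x : 'M[R]_(N, n) := \matrix_(u, j) (((enum_val u).2 == j)%:R *
  (cf (enum_val u).1 x * q j (xi (enum_val u).1) / q j x)).
have sumE (F : I * 'I_n -> R) : \sum_(u < N) F (enum_val u) = \sum_i \sum_j F (i, j).
  by rewrite -(big_enum_val F) pair_bigA /=; apply: eq_bigr => -[].
pose Psi k x : 'M[R]_(N, n) := \matrix_(u, j) k_ k (pt (enum_val u)) (x, j).
have GY k x : in_box x -> G k *m Y x = Psi k x.
  move=> Bx; apply/matrixP => u j; rewrite !mxE.
  under eq_bigr do rewrite !mxE.
  rewrite (sumE (fun v => k_ k (pt (enum_val u)) (pt v) *
    ((v.2 == j)%:R * (cf v.1 x * q j (xi v.1) / q j x)))) /=.
  have qx := q_gt0 j Bx; apply: (mulfI (lt0r_neq0 qx)).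
  rewrite (cfE _ (kernel_interpolable k j (Bpt (enum_val u))) x Bx) mulr_sumr.
  apply: eq_bigr => i _; rewrite (bigD1 j) //= big1 ?addr0.
    by rewrite eqxx mul1r; field; exact: lt0r_neq0.
  by move=> j' /negPf ->; rewrite mul0r mulr0.
have sumPsi x : in_box x -> \sum_k x 0 k *: Psi k x = J *m f x.
  move=> Bx; apply/matrixP => u j; rewrite summxE !mxE.
  under eq_bigr do rewrite !mxE.
  rewrite k_sum // (bigD1 (enum_val u).2) //= big1 ?addr0.
    by rewrite mxE eqxx mul1r.
  by move=> i iu; rewrite mxE eq_sym (negPf iu) mul0r.
have JY x : in_box x -> J^T *m Y x = 1%:M.
  move=> Bx; apply/matrixP => i j; rewrite !mxE.
  under eq_bigr do rewrite !mxE.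
  rewrite (sumE (fun v => (v.2 == i)%:R * ((v.2 == j)%:R *
    (cf v.1 x * q j (xi v.1) / q j x)))) /=.
  under eq_bigr => i' _.
    rewrite (bigD1 i) //= eqxx mul1r big1 ?addr0; first over.
    by move=> j' /negPf ->; rewrite mul0r.
  rewrite -mulr_sumr -mulr_suml -(cfE _ (q_int j) x Bx) mulfV ?mulr1 //.
  exact/lt0r_neq0/q_gt0.
have X0J : X0 *m J = 1%:M.
  apply/matrixP => i j; rewrite !mxE.
  under eq_bigr do rewrite !mxE.
  rewrite (sumE (fun v => (v == (i0, i))%:R * (v.2 == j)%:R)) /=.
  rewrite (bigD1 i0) //= (bigD1 i) //= !eqxx mul1r big1 ?addr0; last first.
    by move=> j' /negPf j'i; rewrite xpair_eqE j'i andbF mul0r.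
  rewrite big1 ?addr0 // => i' /negPf i'i0; rewrite big1 // => j' _.
  by rewrite xpair_eqE i'i0 mul0r.
(* X J = (1, 0), and J^T Y = 1 gives X^T (1, Y) = Y; hence X G_k X^T sends (1, Y) to X G_k Y. *)
pose X := col_mx X0 (1%:M - J *m X0).
exists N, (fun k => X *m G k *m X^T); split=> [k|x Bx].
  split.
    rewrite !trmx_mul trmxK mulmxA; congr (_ *m _ *m _).
    by apply/matrixP => u v; rewrite !mxE; apply: (k_ker k).1; exact: Bpt.
  move=> v; rewrite !mulmxA -mulmxA -[X in _ *m X]trmxK trmx_mul trmxK.
  set w := v^T *m X; rewrite mxE.
  have := (k_ker k).2 _ (fun u => pt (enum_val u)) (w 0) (fun u => Bpt _).
  rewrite (_ : \sum_i _ = \sum_j (w *m G k) 0 j * w^T j 0) // exchange_big /=.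
  apply: eq_bigr => j _; rewrite !mxE mulr_suml; apply: eq_bigr => i _.
  by rewrite !mxE mulrAC.
exists (Y x).
have XY : X^T *m col_mx 1%:M (Y x) = Y x.
  rewrite tr_col_mx mul_row_col mulmx1 linearB /= trmx1 trmx_mul mulmxBl mul1mx.
  by rewrite -mulmxA JY // mulmx1 addrC subrK.
rewrite mulmx_suml.
under eq_bigr => k _ do rewrite -scalemxAl -mulmxA XY -mulmxA GY // scalemxAr.
rewrite -mulmx_sumr sumPsi // mul_col_mx mulmxA X0J mul1mx.
by rewrite mulmxBl mul1mx -mulmxA (mulmxA X0) X0J mul1mx subrr.
Qed.

End KernelRealization.

End BoxInterpolation.

(** * Real positive semidefinite pencils *)

Section RealMatrices.
Context {R : realType}.
Local Notation C := R[i].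
Local Notation cmx := (map_mx (real_complex R)).

Lemma conjE (c : C) : Num.conj c = conjc c. Proof. by []. Qed.

Lemma conj_real (r : R) : Num.conj r%:C%C = r%:C%C.
Proof. by rewrite conjE conjc_real. Qed.

Lemma conj_i : Num.conj ('i%C : C) = - 'i%C.
Proof. by apply/eqP; rewrite conjE eq_complex /= oppr0 !eqxx. Qed.

Lemma conj_cmx p q (M : 'M[R]_(p, q)) : map_mx Num.conj (cmx M) = cmx M.
Proof. by apply/matrixP => i j; rewrite !mxE conj_real. Qed.

(** Viewing the bilinear form as a kernel on vectors makes [real_kernel_null] its Cauchy-Schwarz
    inequality. *)
Lemma psd_mx_kernel N (A : 'M[R]_N) : real_psd_mx A ->
  real_kernel (fun=> True) (fun x y : 'cV[R]_N => (x^T *m A *m y) 0 0).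
Proof.
move=> [As Ap]; split=> [x y _ _|I t c _].
  have -> : y^T *m A *m x = (x^T *m A *m y)^T by rewrite !trmx_mul trmxK As mulmxA.
  by rewrite [RHS]mxE.
have := Ap (\sum_i c i *: t i); rewrite [(\sum_i _)^T]linear_sum /=.
rewrite mulmx_suml mulmx_suml summxE.
congr (0 <= _); apply: eq_bigr => i _; rewrite mulmx_sumr summxE.
apply: eq_bigr => j _.
by rewrite [(_ *: _)^T]linearZ /= -!scalemxAl -scalemxAr !mxE mulrA.
Qed.

Lemma psd_mx_null N (A : 'M[R]_N) (x : 'cV[R]_N) : real_psd_mx A ->
  (x^T *m A *m x) 0 0 = 0 -> A *m x = 0.
Proof.
move=> Ap x0; apply/colP => i.
have := @real_kernel_null _ _ _ _ 'I_1 (fun=> x) (fun=> 1) (delta_mx i 0)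
  (psd_mx_kernel Ap) (fun=> I) I.
rewrite !big_ord1 !mul1r => /(_ x0) /=.
by rewrite trmx_delta -mulmxA -rowE [LHS]mxE => ->; rewrite mxE.
Qed.

Lemma cplx_decomp p q (M : 'M[C]_(p, q)) :
  M = cmx (map_mx (@complex.Re R) M) + 'i%C *: cmx (map_mx (@complex.Im R) M).
Proof. by apply/matrixP => i j; rewrite !mxE {1}[M i j]complexE. Qed.

(** For y = a + i b the mixed terms cancel by symmetry of A, leaving a^T A a + b^T A b. *)
Lemma psd_form N (A : 'M[R]_N) (y : 'cV[C]_N) : real_psd_mx A ->
  exists r : R, [/\ 0 <= r, (y^t* *m cmx A *m y) 0 0 = r%:C%C &
    r = 0 -> cmx A *m y = 0].
Proof.
move=> Ap; pose a := map_mx (@complex.Re R) y; pose b := map_mx (@complex.Im R) y.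
exists ((a^T *m A *m a) 0 0 + (b^T *m A *m b) 0 0); split.
- by apply: addr_ge0; exact: Ap.2.
- have yE : y = cmx a + 'i%C *: cmx b := cplx_decomp y.
  have yc : y^t* = cmx a^T - 'i%C *: cmx b^T.
    rewrite yE; apply/matrixP => i j; rewrite !mxE rmorphD rmorphM /= !conj_real.
    by rewrite conj_i mulNr.
  rewrite yc yE !mulmxDl !mulmxDr !mulNmx -!scalemxAl -!scalemxAr -!map_mxM.
  have -> : b^T *m A *m a = a^T *m A *m b.
    have tr1 (M : 'M[R]_1) : M^T = M by apply/matrixP => u v; rewrite mxE !ord1.
    by rewrite -[LHS]tr1 !trmx_mul trmxK Ap.1 mulmxA.
  have [X XE] : exists X, X = cmx (a^T *m A *m a) by eexists.
  have [W WE] : exists W, W = cmx (b^T *m A *m b) by eexists.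
  have [Z ZE] : exists Z, Z = cmx (a^T *m A *m b) by eexists.
  have XE0 : (((a^T *m A *m a) 0 0 + (b^T *m A *m b) 0 0)%:C)%C = X 0 0 + W 0 0.
    by rewrite XE WE rmorphD [in RHS]mxE [in X in _ = _ + X]mxE.
  rewrite XE0 -XE -WE -ZE !mxE.
  by rewrite (mulrA 'i%C 'i%C) -expr2 sqr_i; ring.
- move=> r0; have [a0 b0] : (a^T *m A *m a) 0 0 = 0 /\ (b^T *m A *m b) 0 0 = 0.
    have := Ap.2 a; have := Ap.2 b; lra.
  rewrite (cplx_decomp y) mulmxDr -scalemxAr -!map_mxM !psd_mx_null //.
  by rewrite map_mx0 scaler0 addr0.
Qed.

End RealMatrices.

Section Pencils.
Context {R : realType} {d : nat}.
Local Notation C := R[i].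
Local Notation cmx := (map_mx (real_complex R)).

Lemma ReZ_real (c : C) (r : R) : complex.Re (c * r%:C%C) = complex.Re c * r.
Proof. by case: c => x y /=; rewrite mulr0 subr0. Qed.

(** Column by column, the real part is a sum of the numbers y^* A_k y >= 0 with weights Re z_k > 0;
    if it is not positive, every one of them is zero. *)
Lemma pencil_null N p (A : 'I_d -> 'M[R]_N) (z : 'rV[C]_d) (y : 'M[C]_(N, p)) :
  (forall k, real_psd_mx (A k)) -> polyhalfplane z ->
  (forall j, complex.Re ((y^t* *m mx_pencil A z *m y) j j) <= 0) ->
  forall k, cmx (A k) *m y = 0.
Proof.
move=> Ap zP yle k; suff cy j : cmx (A k) *m col j y = 0.
  apply/matrixP => i j; have /colP/(_ i) := cy j.
  by rewrite colE mulmxA -colE mxE => ->; rewrite !mxE.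
have [r rE] := choice (fun k => psd_form (col j y) (Ap k)).
have [rk0 _ ->] := rE k => //.
have : \sum_k' complex.Re (z 0 k') * r k' <= 0.
  rewrite (_ : \sum_k' _ = complex.Re ((y^t* *m mx_pencil A z *m y) j j)) //.
  rewrite (_ : (y^t* *m _ *m y) j j = ((col j y)^t* *m mx_pencil A z *m col j y) 0 0).
    rewrite mulmx_sumr mulmx_suml summxE raddf_sum; apply: eq_bigr => k' _ /=.
    rewrite -scalemxAr -scalemxAl mxE.
    by have [_ -> _] := rE k'; rewrite ReZ_real.
  rewrite !mxE; apply: eq_bigr => i _; rewrite !mxE; congr (_ * _).
  by apply: eq_bigr => u _; rewrite !mxE.
have t0 k' : 0 <= complex.Re (z 0 k') * r k'.
  by rewrite mulr_ge0 ?(ltW (zP k')) //; case: (rE k').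
move=> s0; have : \sum_k' complex.Re (z 0 k') * r k' = 0.
  by apply/le_anti; rewrite s0 sumr_ge0.
move/psumr_eq0P => /(_ (fun k' _ => t0 k') k isT)/eqP.
by rewrite mulf_eq0 gt_eqF ?zP //= => /eqP.
Qed.

Lemma pencil_sub (n m : nat) (A : 'I_d -> 'M[R]_(n + m)) z :
  drsubmx (mx_pencil A z) = mx_pencil (fun k => drsubmx (A k)) z.
Proof.
apply/matrixP => i j; rewrite !mxE !summxE; apply: eq_bigr => k _.
by rewrite !mxE.
Qed.

Lemma psd_drsub n m (A : 'M[R]_(n + m)) : real_psd_mx A -> real_psd_mx (drsubmx A).
Proof.
move=> [As Ap]; split; first by rewrite trmx_drsub As.
move=> x; have := Ap (col_mx 0 x).
rewrite -{1}[A]submxK tr_col_mx trmx0 mul_row_block !mul0mx !add0r mul_row_col.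
by rewrite mulmx0 add0r.
Qed.

Lemma pencil_sym N (A : 'I_d -> 'M[R]_N) z :
  (forall k, (A k)^T = A k) -> (mx_pencil A z)^T = mx_pencil A z.
Proof.
move=> As; apply/matrixP => i j; rewrite mxE !summxE; apply: eq_bigr => k _.
by rewrite !mxE -[in LHS]As mxE.
Qed.

Lemma pencilZ N (A : 'I_d -> 'M[R]_N) c z :
  mx_pencil A (c *: z) = c *: mx_pencil A z.
Proof.
by rewrite scaler_sumr; apply: eq_bigr => k _; rewrite mxE scalerA.
Qed.

(** A null vector at one point of the poly-halfplane is annihilated by every A_k, hence by the
    pencil at every point of C^d. *)
Lemma pencil_det_halfplane N (A : 'I_d -> 'M[R]_N) z0 z :
  (forall k, real_psd_mx (A k)) -> \det (mx_pencil A z0) != 0 ->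
  polyhalfplane z -> \det (mx_pencil A z) != 0.
Proof.
move=> Ap d0 zP; apply: contra d0 => /det0P[v v0 vA]; apply/det0P; exists v => //.
have Av : mx_pencil A z *m v^T = 0.
  by rewrite -(pencil_sym z (fun k => (Ap k).1)) -trmx_mul vA trmx0.
have Ak k : cmx (A k) *m v^T = 0.
  by apply: (pencil_null Ap zP) => j; rewrite -mulmxA Av mulmx0 mxE.
apply: trmx_inj; rewrite trmx_mul (pencil_sym z0 (fun k => (Ap k).1)) trmx0.
rewrite mulmx_suml big1 // => k _.
by rewrite -scalemxAl Ak scaler0.
Qed.

Lemma pencil_det_Omega N (A : 'I_d -> 'M[R]_N) z0 z :
  (forall k, real_psd_mx (A k)) -> \det (mx_pencil A z0) != 0 ->
  Omega z -> \det (mx_pencil A z) != 0.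
Proof.
move=> Ap d0 [c [c1 [v vP ->]]]; rewrite pencilZ detZ.
rewrite mulf_neq0 ?(pencil_det_halfplane Ap d0 vP) // expf_neq0 //.
by rewrite -normr_eq0 c1 oner_eq0.
Qed.

Lemma drsub_det_halfplane n m (A : 'I_d -> 'M[R]_(n + m)) z0 z :
  (forall k, real_psd_mx (A k)) -> \det (drsubmx (mx_pencil A z0)) != 0 ->
  polyhalfplane z -> \det (drsubmx (mx_pencil A z)) != 0.
Proof.
rewrite !pencil_sub => Ap; apply: pencil_det_halfplane => k; exact: psd_drsub.
Qed.

Lemma drsub_det_Omega n m (A : 'I_d -> 'M[R]_(n + m)) z0 z :
  (forall k, real_psd_mx (A k)) -> \det (drsubmx (mx_pencil A z0)) != 0 ->
  Omega z -> \det (drsubmx (mx_pencil A z)) != 0.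
Proof.
rewrite !pencil_sub => Ap; apply: pencil_det_Omega => k; exact: psd_drsub.
Qed.

Section SchurComplement.
Context {n m : nat}.
Implicit Types (M : 'M[C]_(n + m)).

Definition schur_vec M : 'M[C]_(n + m, n) :=
  col_mx 1%:M (- (invmx (drsubmx M) *m dlsubmx M)).

Lemma mul_schur_vec M : \det (drsubmx M) != 0 ->
  M *m schur_vec M = col_mx (schur_compl M) 0.
Proof.
move=> M0; rewrite -{1}[M]submxK mul_block_col !mulmx1 !mulmxN !mulmxA.
by rewrite mulmxV ?unitmxE ?unitfE // mul1mx subrr.
Qed.

(** Realizations are recognized through this lemma: it is enough to exhibit some solution of the
    block system, without inverting anything. *)
Lemma schur_compl_unique M (Y : 'M[C]_(m, n)) (g : 'M[C]_n) :
  \det (drsubmx M) != 0 -> M *m col_mx 1%:M Y = col_mx g 0 ->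
  schur_compl M = g.
Proof.
move=> M0; rewrite -{1}[M]submxK mul_block_col !mulmx1 => /eq_col_mx[<-].
move=> /(congr1 (mulmx (invmx (drsubmx M)))).
rewrite mulmxDr mulKmx ?unitmxE ?unitfE // mulmx0 => /eqP.
by rewrite addrC addr_eq0 => /eqP ->; rewrite mulmxN mulmxA.
Qed.

End SchurComplement.

End Pencils.

Section Realizations.
Context {R : realType} {d n : nat}.
Local Notation C := R[i].
Local Notation cmx := (map_mx (real_complex R)).

(** The polynomial substitution g allows the vector to be read as a function of z alone or of the
    pair (conj w, z). *)
Lemma schur_vec_regfun D m (S : set 'rV[C]_D) (A : 'I_d -> 'M[R]_(n + m))
    (g : 'rV[C]_D -> 'rV[C]_d) :
  (forall k, polyfun (fun x => g x 0 k)) ->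
  (forall x, S x -> \det (drsubmx (mx_pencil A (g x))) != 0) ->
  forall i j, regfun S (fun x => schur_vec (mx_pencil A (g x)) i j).
Proof.
move=> pg d0 i j.
have pA u v : polyfun (fun x => mx_pencil A (g x) u v).
  apply: (@eq_polyfun _ _ (fun x => \sum_k g x 0 k * ((A k) u v)%:C%C)).
    by move=> x; rewrite summxE; apply: eq_bigr => k _; rewrite !mxE.
  by apply: polyfun_sum => k; apply: polyfunM => //; exact: polyfun_cst.
have rinv u v : regfun S (fun x => invmx (drsubmx (mx_pencil A (g x))) u v).
  apply: regfun_invmx => // u' v'.
  by apply: eq_polyfun (pA (rshift n u') (rshift n v')) => x; rewrite !mxE.
have rdl u v : regfun S (fun x => dlsubmx (mx_pencil A (g x)) u v).
  apply: regfun_polyfun.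
  by apply: eq_polyfun (pA (rshift n u) (lshift m v)) => x; rewrite !mxE.
case: (split_ordP i) => u ->.
  apply: (@eq_regfun _ _ _ (fun=> (u == j)%:R)).
    by move=> x; rewrite col_mxEu mxE.
  exact/regfun_polyfun/polyfun_cst.
apply: (@eq_regfun _ _ _ (fun x => -1 *
    (invmx (drsubmx (mx_pencil A (g x))) *m dlsubmx (mx_pencil A (g x))) u j)).
  by move=> x; rewrite col_mxEd mulN1r [RHS]mxE.
by apply: regfunM; [exact/regfun_polyfun/polyfun_cst | exact: regfun_mulmx].
Qed.

Lemma schur_compl_regfun m (S : set 'rV[C]_d) (A : 'I_d -> 'M[R]_(n + m)) :
  (forall x, S x -> \det (drsubmx (mx_pencil A x)) != 0) ->
  forall i j, regfun S (fun x => schur_compl (mx_pencil A x) i j).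
Proof.
move=> d0 i j.
apply: (@eq_regfun _ _ _
    (fun x => (mx_pencil A x *m schur_vec (mx_pencil A x)) (lshift m i) j)).
  move=> x; rewrite -{1}[mx_pencil A x]submxK mul_block_col col_mxEu mulmx1.
  by rewrite mulmxN mulmxA.
apply: regfun_mulmx => u v; last first.
  by apply: (@schur_vec_regfun d m S A id) => // k; exact: polyfun_coord.
apply: regfun_polyfun.
apply: (@eq_polyfun _ _ (fun x => \sum_k x 0 k * ((A k) u v)%:C%C)).
  by move=> x; rewrite summxE; apply: eq_bigr => k _; rewrite !mxE.
by apply: polyfun_sum => k; apply: polyfunM; [exact: polyfun_coord|exact: polyfun_cst].
Qed.

Lemma RB_of_pencil m (A : 'I_d -> 'M[R]_(n + m)) z0 (f : 'rV[C]_d -> 'M[C]_n) :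
  (forall k, real_psd_mx (A k)) -> \det (drsubmx (mx_pencil A z0)) != 0 ->
  (forall z, polyhalfplane z -> exists Y,
     mx_pencil A z *m col_mx 1%:M Y = col_mx (f z) 0) ->
  restriction_of f RB_class.
Proof.
move=> Ap d0 AY; exists (fun z => schur_compl (mx_pencil A z)).
  move=> z zP; have [Y YE] := AY z zP; apply/esym; apply: schur_compl_unique YE.
  exact: drsub_det_halfplane d0 zP.
split; last by exists m, A; split=> //; exists z0.
move=> i j.
have [|P [Q [Q0 PQ]]] := regfun_rational _ (schur_compl_regfun
  (S := [set z | \det (drsubmx (mx_pencil A z)) != 0]) (fun _ h => h) i j).
  by exists z0.
by exists P, Q; split=> // z _; exact: PQ.
Qed.

Lemma mx_normal_null p q (M : 'M[C]_(p, q)) : M^t* *m M = 0 -> M = 0.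
Proof.
move=> M0; apply/matrixP => i j; rewrite mxE.
have /matrixP/(_ j j) := M0; rewrite !mxE.
under eq_bigr do rewrite !mxE mulrC -normCK.
move=> /psumr_eq0P => /(_ (fun k _ => exprn_ge0 _ (normr_ge0 _)) i isT)/eqP.
by rewrite expf_eq0 normr_eq0 => /eqP.
Qed.

Lemma mx_normal_null_real p q (M : 'M[R]_(p, q)) : M^T *m M = 0 -> M = 0.
Proof.
move=> M0; apply: (map_mx_inj (f := real_complex R)); rewrite map_mx0.
by apply: mx_normal_null; rewrite map_trmx conj_cmx -map_mxM M0 map_mx0.
Qed.

Local Notation ones := (const_mx 1 : 'rV[C]_d).

Lemma ones_halfplane : polyhalfplane ones.
Proof. by move=> k; rewrite mxE /= ltr01. Qed.

Lemma pencil_ones N (A : 'I_d -> 'M[R]_N) :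
  mx_pencil A ones = cmx (\sum_k A k).
Proof.
rewrite raddf_sum; apply: eq_bigr => k _.
by rewrite mxE scale1r.
Qed.

(* Compression to C^n (+) the row space of A_22(1, ..., 1), which is the
   orthogonal complement of the common kernel of the blocks (A_k)_22. *)
Lemma pencil_reduction m (A : 'I_d -> 'M[R]_(n + m)) :
  (forall k, real_psd_mx (A k)) ->
  exists m' (A' : 'I_d -> 'M[R]_(n + m')),
  [/\ forall k, real_psd_mx (A' k), \det (drsubmx (mx_pencil A' ones)) != 0 &
    forall z (g : 'M[C]_n) Y, mx_pencil A z *m col_mx 1%:M Y = col_mx g 0 ->
      exists Y', mx_pencil A' z *m col_mx 1%:M Y' = col_mx g 0].
Proof.
move=> Ap; pose G := \sum_k drsubmx (A k).
have Gs : G^T = G.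
  by rewrite /G raddf_sum; apply: eq_bigr => k _; exact: (psd_drsub (Ap k)).1.
pose B := row_base G; pose X : 'M[R]_(n + _, n + m) := block_mx 1%:M 0 0 B.
have /submxP[W GW] : (G <= B)%MS by rewrite eq_row_base.
have /submxP[V BV] : (B <= G)%MS by rewrite eq_row_base.
have drX (M : 'M[R]_(n + m)) : drsubmx (X *m M *m X^T) = B *m drsubmx M *m B^T.
  rewrite -{1}[M]submxK tr_block_mx !trmx0 trmx1 !mulmx_block block_mxKdr.
  by rewrite !(mul0mx, mulmx0, mul1mx, mulmx1, add0r, addr0).
pose H := B *m G *m B^T.
have Gp : real_psd_mx G.
  split=> // x; rewrite mulmx_sumr mulmx_suml summxE; apply: sumr_ge0 => k _.
  exact: (psd_drsub (Ap k)).2.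
(* For a left null vector v of H the vector vB is in the kernel of G, and it is also in the row
   space of the symmetric matrix G; so it is zero. *)
have Hu : \det H != 0.
  apply/negP => /det0P[v v0 vH].
  have wG : G *m (v *m B)^T = 0.
    apply: psd_mx_null Gp _; rewrite trmxK trmx_mul !mulmxA.
    by move: vH; rewrite /H !mulmxA => ->; rewrite mul0mx mxE.
  have : v *m B = 0.
    apply: trmx_inj; rewrite trmx0; apply: mx_normal_null_real.
    have vVG : v *m B = v *m V *m G by rewrite {1}BV mulmxA.
    by rewrite trmxK [X in X *m _]vVG -(mulmxA (v *m V) G) wG mulmx0.
  move=> vB; case/negP: v0; apply/eqP; apply: (row_free_inj (row_base_free G)).
  by rewrite -/B /= vB mul0mx.
exists (\rank G), (fun k => X *m A k *m X^T); split=> [k||z g Y YE].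
- split; first by rewrite !trmx_mul trmxK (Ap k).1 mulmxA.
  move=> x; have := (Ap k).2 (X^T *m x); rewrite trmx_mul trmxK.
  by rewrite !mulmxA.
- rewrite pencil_sub pencil_ones (eq_bigr (fun k => B *m drsubmx (A k) *m B^T)).
    by rewrite -mulmx_suml -mulmx_sumr det_map_mx fmorph_eq0.
  by move=> k _; exact: drX.
(* Y' is chosen so that B G (Y - B^T Y') = 0; as G factors through B on the left, the discarded part
   N satisfies G N = 0. *)
pose Y' := cmx (invmx H *m B *m G) *m Y.
pose N := Y - cmx B^T *m Y'.
have GN : cmx G *m N = 0.
  have : cmx (B *m G) *m N = 0.
    rewrite mulmxBr mulmxA -map_mxM /Y' mulmxA -map_mxM !mulmxA.
    by rewrite mulmxV ?unitmxE ?unitfE // mul1mx subrr.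
  move=> BGN; apply: mx_normal_null.
  have GH : (cmx G)^t* = cmx G.
    by apply/matrixP => i j; rewrite !mxE conj_real -[in RHS]Gs mxE.
  rewrite trmx_mul map_mxM GH -mulmxA {1}GW map_mxM -mulmxA.
  by rewrite (mulmxA (cmx B)) -map_mxM BGN !mulmx0.
have dG : drsubmx (\sum_k A k) = G.
  by apply/matrixP => i j; rewrite !mxE !summxE; apply: eq_bigr => k _; rewrite !mxE.
(* The form of A(1, ..., 1) vanishes on (0, N), so each A_k annihilates it and dropping N does not
   affect the pencil. *)
have AN k : cmx (A k) *m col_mx 0 N = 0.
  apply: (pencil_null Ap ones_halfplane) => j.
  rewrite pencil_ones tr_col_mx map_row_mx trmx0 map_mx0.
  rewrite -{1}[\sum_k A k]submxK map_block_mx mul_row_block !mul0mx !add0r.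
  rewrite mul_row_col mulmx0 add0r dG -mulmxA GN mulmx0 mxE.
  by rewrite lexx.
exists Y'.
have XY : cmx X^T *m col_mx 1%:M Y' = col_mx 1%:M Y - col_mx 0 N.
  rewrite opp_col_mx add_col_mx oppr0 addr0 opprB addrC subrK.
  rewrite tr_block_mx !trmx0 trmx1 map_block_mx mul_block_col !map_mx0 map_mx1.
  by rewrite !mul0mx !mulmx1 addr0 add0r.
have -> : mx_pencil (fun k => X *m A k *m X^T) z *m col_mx 1%:M Y' =
    cmx X *m (mx_pencil A z *m col_mx 1%:M Y).
  rewrite mulmx_suml [mx_pencil A z *m _]mulmx_suml mulmx_sumr.
  apply: eq_bigr => k _; rewrite -!scalemxAl -scalemxAr; congr (_ *: _).
  by rewrite !map_mxM -!mulmxA XY mulmxBr AN subr0.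
rewrite YE map_block_mx mul_block_col !map_mx0 map_mx1.
by rewrite !mul0mx mul1mx !mulmx0 !addr0.
Qed.

End Realizations.

(** * Realization of a kernel decomposition *)

Section RestrictedPolynomials.
Context {R : realType} {d : nat}.
Local Notation C := R[i].
Local Notation cmx := (map_mx (real_complex R)).

Lemma polyfun_meval (P : mpoly d C) : polyfun (fun z : 'rV[C]_d => meval (z 0) P).
Proof.
apply: (@eq_polyfun _ _ (fun z =>
    \sum_(m <- msupp P) mcoeff m P * \prod_i z 0 i ^+ m i)).
  by move=> z; rewrite mevalE.
apply: polyfun_sum => m; apply: polyfunM; first exact: polyfun_cst.
apply: polyfun_prod => i; elim: (m i) => [|k IH].
  by apply: eq_polyfun (polyfun_cst 1) => z; rewrite expr0.
by apply: eq_polyfun (polyfunM (polyfun_coord i) IH) => z; rewrite exprS.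
Qed.

Lemma nonvanishing_point (Q : mpoly d C) (a b : 'I_d -> R) :
  (forall k, a k < b k) -> Q != 0 ->
  exists2 x : 'rV[R]_d, in_box a b x & meval (cmx x 0) Q != 0.
Proof.
move=> ab Q0.
pose S k c := exists t : R, a k < t < b k /\ c = t%:C%C.
have [k p p0|v [Sv Qv]] := @mpoly_neq0_point _ _ Q S _ Q0.
  have ba : 0 < b k - a k by rewrite subr_gt0.
  have [t [/andP[t0 tb] pt]] := near_nonroot (a k)%:C%C p0 ba.
  exists ((a k)%:C%C + t%:C%C); split=> //; exists (a k + t).
  by rewrite rmorphD; split => //; lra.
have [x xE] := choice Sv; exists (\row_k x k).
  by move=> k; rewrite mxE; exact: (xE k).1.
rewrite (@meval_eq _ _ _ v) // => k; by rewrite !mxE (xE k).2.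
Qed.

Lemma nonvanishing_box (Q : mpoly d C) : Q != 0 ->
  exists a b : 'I_d -> R, [/\ forall k, 0 <= a k, forall k, a k < b k &
    forall x : 'rV[R]_d, in_box a b x -> meval (cmx x 0) Q != 0].
Proof.
move=> Q0; have [c cB Qc] := @nonvanishing_point Q (fun=> 0) (fun=> 1) (fun=> ltr01) Q0.
have [_ /(_ (cmx c)) dQ] := polyfun_meval Q.
have [e e0 Qe] : exists2 e : C, 0 < e & forall y : 'rV[C]_d,
    (forall j, `|cmx c 0 j - y 0 j| < e) -> meval (y 0) Q != 0.
  apply: contrapT => nQ; move/negP: Qc; apply; apply/eqP.
  apply: (@cdiff_eq0 C _ _ _ dQ) => e e0; apply: contrapT => ny; apply: nQ.
  exists e => // y ye; apply/eqP => Qy; apply: ny; by exists y.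
have [r re] : exists r : R, r%:C%C = e.
  by exists (complex.Re e); rewrite RRe_real // gtr0_real.
have r0 : 0 < r by rewrite -ltcR re.
(* Cutting off at 0 keeps the box in the nonnegative reals; no side collapses since the centre c has
   positive coordinates. *)
exists (fun k => Num.max 0 (c 0 k - r)), (fun k => c 0 k + r); split=> [k|k|x xB].
- by rewrite le_max lexx.
- by rewrite gt_max; have /andP[c0 _] := cB k; lra.
apply: Qe => k; rewrite !mxE -rmorphB normc_def /= expr0n addr0 sqrtr_sqr -re ltcR.
have := xB k; rewrite gt_max ltr_norml => /andP[/andP[_ x1] x2]; lra.
Qed.

Definition cmplx_poly_Re (r : {poly C}) : {poly R} :=
  \poly_(i < size r) complex.Re r`_i.

Lemma cmplx_poly_ReE (r : {poly C}) (s : R) :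
  (cmplx_poly_Re r).[s] = complex.Re r.[s%:C%C].
Proof.
rewrite horner_poly horner_coef raddf_sum; apply: eq_bigr => i _ /=.
by rewrite -rmorphXn ReZ_real.
Qed.

Lemma separately_poly_Re (P : mpoly d C) :
  separately_poly (msize P) (fun x : 'rV[R]_d => complex.Re (meval (cmx x 0) P)).
Proof.
move=> x l.
pose r : {poly C} := \sum_(m <- msupp P)
  (mcoeff m P * \prod_(i < d | i != l) (x 0 i)%:C%C ^+ m i) *: 'X^(m l).
exists (cmplx_poly_Re r); split.
  apply: leq_trans (size_poly _ _) _; apply: leq_trans (size_sum _ _ _) _.
  apply/bigmax_leqP_seq => m mP _; apply: leq_trans (size_scale_leq _ _) _.
  rewrite size_polyXn; apply: leq_ltn_trans (msize_mdeg_lt mP).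
  by rewrite mdegE (bigD1 l) //= leq_addr.
move=> s; rewrite cmplx_poly_ReE mevalE horner_sum; congr complex.Re.
apply: eq_bigr => m _; rewrite hornerZ hornerXn -mulrA; congr (_ * _).
rewrite (bigD1 l) //= !mxE eqxx mulrC; congr (_ * _).
by apply: eq_bigr => i /negPf il; rewrite !mxE il.
Qed.

Lemma separately_polyD m1 m2 (g h : 'rV[R]_d -> R) :
  separately_poly m1 g -> separately_poly m2 h ->
  separately_poly (m1 + m2) (fun x => g x + h x).
Proof.
move=> gp hp x l; have [r [sr rE]] := gp x l; have [t [st tE]] := hp x l.
exists (r + t); split; last by move=> s; rewrite rE tE hornerD.
by rewrite (leq_trans (size_polyD _ _)) // geq_max (leq_trans sr) ?leq_addr //
  (leq_trans st) ?leq_addl.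
Qed.

Lemma separately_polyM m1 m2 (g h : 'rV[R]_d -> R) :
  separately_poly m1 g -> separately_poly m2 h ->
  separately_poly (m1 + m2) (fun x => g x * h x).
Proof.
move=> gp hp x l; have [r [sr rE]] := gp x l; have [t [st tE]] := hp x l.
exists (r * t); split; last by move=> s; rewrite rE tE hornerM.
apply: leq_trans (size_polyMleq _ _) _.
by apply: leq_trans (leq_pred _) _; exact: leq_add.
Qed.

Lemma separately_poly_le m1 m2 (g : 'rV[R]_d -> R) : (m1 <= m2)%N ->
  separately_poly m1 g -> separately_poly m2 g.
Proof.
move=> m12 gp x l; have [r [sr rE]] := gp x l.
by exists r; split=> //; exact: leq_trans m12.
Qed.

End RestrictedPolynomials.

Section WeakRealization.
Context {R : realType} {d n : nat}.
Local Notation C := R[i].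
Local Notation cmx := (map_mx (real_complex R)).

Definition positive_reals : set 'rV[C]_d :=
  [set z | exists2 x : 'rV[R]_d, forall k, 0 < x 0 k & z = cmx x].

Lemma cdotE (u v : 'cV[C]_n) : cdot u v = \sum_k Num.conj (v k 0) * u k 0.
Proof. by rewrite /cdot mxE; apply: eq_bigr => k _; rewrite !mxE. Qed.

Lemma cdot_delta (M : 'M[C]_n) (c c' : C) i j :
  cdot (M *m (c *: delta_mx j 0)) (c' *: delta_mx i 0) =
  Num.conj c' * (c * M i j).
Proof.
rewrite cdotE -scalemxAr -colE (bigD1 i) //= big1 ?addr0.
  by rewrite !mxE !eqxx mulr1.
by move=> k /negPf ki; rewrite !mxE ki mulr0 rmorph0 mul0r.
Qed.

Lemma Im_ge0 (c : C) : 0 <= c -> complex.Im c = 0.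
Proof. by rewrite lecE => /andP[/eqP]. Qed.

Lemma Re_ge0 (c : C) : 0 <= c -> 0 <= complex.Re c.
Proof. by rewrite lecE => /andP[]. Qed.

Lemma conj_fixed_real (c : C) : Num.conj c = c -> c = (complex.Re c)%:C%C.
Proof.
case: c => x y; rewrite conjE /= => -[] yN; congr (_ +i* _)%C; lra.
Qed.

Lemma positive_kernel_fin L (Th : 'rV[C]_d -> 'rV[C]_d -> 'M[C]_n)
    (I : finType) (l : I -> 'rV[C]_d) (u : I -> 'cV[C]_n) :
  positive_kernel L Th -> (forall i, L (l i)) ->
  0 <= \sum_i \sum_j cdot (Th (l i) (l j) *m u j) (u i).
Proof.
move=> Tp Ll.
have := Tp #|I| (l \o enum_val) (u \o enum_val) (fun i => Ll _).
have ev : {on [pred i | true], bijective (@enum_val I (mem I))}.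
  exact/onW_bij/enum_val_bij.
congr (0 <= _); rewrite [RHS](reindex _ ev); apply: eq_bigr => i _.
by rewrite [RHS](reindex _ ev).
Qed.

(** Nonnegative complex numbers are real: testing a real-valued kernel at two points with the
    coefficients 1 and i yields imaginary part v - w. This is how symmetry is deduced from
    positivity. *)
Lemma ge0_sym (u v w p : R) :
  0 <= Num.conj 1 * (1 * u%:C%C) + Num.conj 1 * ('i%C * v%:C%C) +
       (Num.conj 'i%C * (1 * w%:C%C) + Num.conj 'i%C * ('i%C * p%:C%C)) ->
  v = w.
Proof.
rewrite rmorph1 conj_i; have -> : 1 * (1 * u%:C%C) + 1 * ('i%C * v%:C%C) +
    (- 'i%C * (1 * w%:C%C) + - 'i%C * ('i%C * p%:C%C)) = ((u + p) +i* (v - w))%C.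
  by apply/eqP; rewrite eq_complex /=; apply/andP; split; apply/eqP; ring.
by move/Im_ge0 => /= /subr0_eq.
Qed.

Lemma positive_kernel_real (Th : 'rV[C]_d -> 'rV[C]_d -> 'M[C]_n) :
  positive_kernel positive_reals Th ->
  (forall w z, positive_reals w -> positive_reals z ->
     map_mx Num.conj (Th w z) = Th w z) ->
  real_kernel (fun t : 'rV[R]_d * 'I_n => forall k, 0 < t.1 0 k)
    (fun s t => complex.Re (Th (cmx s.1) (cmx t.1) s.2 t.2)).
Proof.
move=> Tp Tr.
have TE (s t : 'rV[R]_d) i j : (forall k, 0 < s 0 k) -> (forall k, 0 < t 0 k) ->
    Th (cmx s) (cmx t) i j = (complex.Re (Th (cmx s) (cmx t) i j))%:C%C.
  move=> s0 t0; apply: conj_fixed_real.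
  have := Tr (cmx s) (cmx t) (ex_intro2 _ _ s s0 erefl) (ex_intro2 _ _ t t0 erefl).
  by move/matrixP => /(_ i j); rewrite mxE.
split=> [[y i] [x j] /= y0 x0|I t c t0].
  pose l (u : bool) := if u then cmx y else cmx x.
  pose e (u : bool) : C := if u then 1 else 'i%C.
  pose v (u : bool) := if u then i else j.
  have l0 u : positive_reals (l u) by case: u; [exists y|exists x].
  have := positive_kernel_fin (fun u => e u *: delta_mx (v u) 0) Tp l0.
  under eq_bigr do under eq_bigr do rewrite cdot_delta.
  rewrite !big_bool (TE y y i i y0 y0 : Th (l true) (l true) (v true) (v true) = _).
  rewrite (TE y x i j y0 x0 : Th (l true) (l false) (v true) (v false) = _).
  rewrite (TE x y j i x0 y0 : Th (l false) (l true) (v false) (v true) = _).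
  rewrite (TE x x j j x0 x0 : Th (l false) (l false) (v false) (v false) = _).
  by move/ge0_sym => /= E; exact: E.
pose l u := cmx (t u).1.
have l0 u : positive_reals (l u) by exists (t u).1.
have := positive_kernel_fin (fun u => (c u)%:C%C *: delta_mx (t u).2 0) Tp l0.
move/Re_ge0; congr (0 <= _); rewrite raddf_sum; apply: eq_bigr => u _.
rewrite raddf_sum; apply: eq_bigr => v _.
rewrite cdot_delta conj_real TE //.
by rewrite /=; ring.
Qed.

Lemma cmx_polyhalfplane (x : 'rV[R]_d) :
  (forall k, 0 < x 0 k) -> polyhalfplane (cmx x).
Proof. by move=> x0 k; rewrite mxE; exact: x0. Qed.

Lemma box_realization (F : 'rV[C]_d -> 'M[C]_n)
    (Phi : 'I_d -> 'rV[C]_d -> 'rV[C]_d -> 'M[C]_n) :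
  rational_on polyhalfplane F ->
  (forall k, positive_kernel positive_reals (Phi k)) ->
  (forall k w z, positive_reals w -> positive_reals z ->
     map_mx Num.conj (Phi k w z) = Phi k w z) ->
  (forall w z, positive_reals w -> positive_reals z ->
     F z = \sum_k z 0 k *: Phi k w z) ->
  exists a b : 'I_d -> R, [/\ forall k, 0 <= a k, forall k, a k < b k &
    exists N (A : 'I_d -> 'M[R]_(n + N)), (forall k, real_psd_mx (A k)) /\
    forall x : 'rV[R]_d, in_box a b x -> exists Y,
      mx_pencil A (cmx x) *m col_mx 1%:M Y = col_mx (F (cmx x)) 0].
Proof.
move=> Frat Phip Phir FE.
have [P PP] := choice (fun j => Frat j j).
have [Q PQ] := choice PP.
have Q0 : \prod_j Q j != 0 by apply/prodf_neq0 => j _; exact: (PQ j).1.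
have [a [b [a0 ab Qab]]] := nonvanishing_box Q0.
exists a, b; split=> //.
have x0 (x : 'rV[R]_d) : in_box a b x -> forall k, 0 < x 0 k.
  by move=> xB k; have /andP[+ _] := xB k; exact: le_lt_trans.
have xp (x : 'rV[R]_d) : in_box a b x -> positive_reals (cmx x).
  by move=> xB; exists x => //; exact: x0.
have Qx j (x : 'rV[R]_d) : in_box a b x -> meval (cmx x 0) (Q j) != 0.
  move=> xB; apply: contraNneq (Qab x xB) => Qj.
  by rewrite rmorph_prod (bigD1 j) //= Qj mul0r.
pose k_ k (s t : 'rV[R]_d * 'I_n) := complex.Re (Phi k (cmx s.1) (cmx t.1) s.2 t.2).
pose f (x : 'rV[R]_d) := map_mx (@complex.Re R) (F (cmx x)).
(* The imaginary part of a polynomial is the real part of its product with -i, so one degree bound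
   covers both. *)
pose ni : C := - 'i%C.
pose Re P (x : 'rV[R]_d) := complex.Re (meval (cmx x 0) (P : mpoly d C)).
pose Im P (x : 'rV[R]_d) := Re (mpolyC d ni * P) x.
have ImE T x : Im T x = complex.Im (meval (cmx x 0) T).
  rewrite /Im /Re mevalM mevalC /ni; case: (meval _ T) => u v /=; ring.
(* At real points P/Q is real and equals Re(P conj Q) / |Q|^2, a quotient of real polynomials with
   positive denominator. *)
pose p j x := Re (P j) x * Re (Q j) x + Im (P j) x * Im (Q j) x.
pose q j x := Re (Q j) x * Re (Q j) x + Im (Q j) x * Im (Q j) x.
pose sz T := (msize T + msize (mpolyC d ni * T)%R)%N.
pose m := (\sum_j (sz (P j) + sz (Q j)))%N.
have szm j : (sz (P j) + sz (Q j) <= m)%N by rewrite /m (bigD1 j) //= leq_addr.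
have Fr x i j : in_box a b x -> F (cmx x) i j = (f x i j)%:C%C.
  move=> xB; rewrite mxE; apply: conj_fixed_real.
  rewrite (FE _ _ (xp x xB) (xp x xB)) summxE rmorph_sum; apply: eq_bigr => k _.
  rewrite !mxE rmorphM /= conj_real; congr (_ * _).
  by have /matrixP/(_ i j) := Phir k _ _ (xp x xB) (xp x xB); rewrite mxE.
have k_ker k : real_kernel (fun t => in_box a b t.1) (k_ k).
  have [ks kp] := positive_kernel_real (Phip k) (Phir k).
  split=> [s t sB tB|I t c tB]; first by apply: ks; exact: x0.
  by apply: kp => i; exact: x0.
have k_sum x y i j : in_box a b x -> in_box a b y ->
    \sum_k x 0 k * k_ k (y, i) (x, j) = f x i j.
  move=> xB yB; rewrite mxE (FE _ _ (xp y yB) (xp x xB)) summxE raddf_sum.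
  apply: eq_bigr => k _ /=; rewrite !mxE /k_ /=.
  by case: (Phi k _ _ i j) => u v /=; rewrite mul0r subr0.
have f_ratio x j : in_box a b x -> f x j j * q j x = p j x.
  move=> xB; have FPQ := (PQ j).2 (cmx x) (cmx_polyhalfplane (x0 x xB)) (Qx j x xB).
  have : (f x j j)%:C%C * meval (cmx x 0) (Q j) = meval (cmx x 0) (P j).
    by rewrite -Fr // FPQ divfK ?Qx.
  rewrite /p /q !ImE /Re; move: (f x j j) (meval _ _) (meval _ _) => fx [qu qv] [pu pv].
  by case=> <- <- /=; ring.
have q_gt0 x j : in_box a b x -> 0 < q j x.
  move=> xB; have := Qx j x xB; rewrite /q ImE /Re.
  case: (meval _ (Q j)) => u v; rewrite eq_complex /= negb_and -!expr2 => uv.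
  rewrite lt_def addr_ge0 ?sqr_ge0 // andbT paddr_eq0 ?sqr_ge0 //.
  by rewrite !sqrf_eq0 negb_and.
have sepRe T : separately_poly (sz T) (Re T).
  by apply: separately_poly_le (separately_poly_Re T); exact: leq_addr.
have sepIm T : separately_poly (sz T) (Im T).
  by apply: separately_poly_le (separately_poly_Re _); exact: leq_addl.
have [||N [A [Ap AY]]] := kernel_realization a0 ab k_ker k_sum f_ratio q_gt0
   (m := (m + m + (m + m))%N).
- move=> j; apply: (separately_poly_le _ (separately_polyD
    (separately_polyM (sepRe (P j)) (sepRe (Q j)))
    (separately_polyM (sepIm (P j)) (sepIm (Q j))))).
  by apply: leq_add; apply: leq_trans (szm j) (leq_addr _ _).
- move=> j; have sQ : (sz (Q j) <= m)%N := leq_trans (leq_addl _ _) (szm j).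
  apply: (separately_poly_le _ (separately_polyD
    (separately_polyM (sepRe (Q j)) (sepRe (Q j)))
    (separately_polyM (sepIm (Q j)) (sepIm (Q j))))).
  by rewrite !leq_add.
exists N, A; split=> // x xB; have [Y YE] := AY x xB; exists (cmx Y).
rewrite (_ : mx_pencil A (cmx x) = cmx (\sum_k x 0 k *: A k)); last first.
  apply/matrixP => u v; rewrite [RHS]mxE !summxE rmorph_sum.
  by apply: eq_bigr => k _; rewrite !mxE rmorphM.
rewrite -(map_mx1 (real_complex R)) -map_col_mx -map_mxM YE map_col_mx map_mx0.
by congr col_mx; apply/matrixP => i j; rewrite [LHS]mxE Fr.
Qed.

End WeakRealization.

Section Weak.
Context {R : realType} {d n : nat}.
Local Notation C := R[i].
Local Notation cmx := (map_mx (real_complex R)).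

(** The kernels are constrained at positive real points only. Everything beyond the box comes from
    F: both F and the Schur complement are rational and holomorphic on the poly-halfplane. *)
Lemma weak_realization (F : 'rV[C]_d -> 'M[C]_n)
    (Phi : 'I_d -> 'rV[C]_d -> 'rV[C]_d -> 'M[C]_n) :
  rational_on polyhalfplane F -> holomorphic_on polyhalfplane F ->
  (forall k, positive_kernel positive_reals (Phi k)) ->
  (forall k w z, positive_reals w -> positive_reals z ->
     map_mx Num.conj (Phi k w z) = Phi k w z) ->
  (forall w z, positive_reals w -> positive_reals z ->
     F z = \sum_k z 0 k *: Phi k w z) ->
  restriction_of F RB_class.
Proof.
move=> Frat Fhol Phip Phir FE.
have [a [b [a0 ab [N [A [Ap AY]]]]]] := box_realization Frat Phip Phir FE.
have [M [B [Bp Bd BY]]] := pencil_reduction Ap.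
have Bdet z : polyhalfplane z -> \det (drsubmx (mx_pencil B z)) != 0.
  exact: drsub_det_halfplane Bp Bd.
have bx (x : 'rV[R]_d) : in_box a b x -> polyhalfplane (cmx x).
  move=> xB; apply: cmx_polyhalfplane => k; have /andP[+ _] := xB k.
  exact: le_lt_trans.
have FS x : in_box a b x -> F (cmx x) = schur_compl (mx_pencil B (cmx x)).
  move=> xB; have [Y YE] := AY x xB; have [Y' Y'E] := BY _ _ _ YE.
  by apply/esym; apply: schur_compl_unique Y'E; apply: Bdet; exact: bx.
suff FSz z : polyhalfplane z -> F z = schur_compl (mx_pencil B z).
  apply: (RB_of_pencil Bp Bd) => z zP; rewrite FSz //.
  by eexists; exact: mul_schur_vec (Bdet z zP).
move=> zP; apply/matrixP => i j.
have [P [Q [Q0 PQ]]] := Frat i j.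
have [p [q [[[p' pp] dp] [[q' qq] dq] q0 pq]]] := schur_compl_regfun Bdet i j.
(* P/Q represents F only where Q does not vanish. The cross product is a polynomial that vanishes on
   the box, hence identically; continuity then covers the zeros of Q. *)
suff Z0 : P * q' - p' * Q = 0.
  have : F z i j * q z + -1 * p z = 0.
    apply: (@halfplane_continuation _ _ (fun y => F y i j * q y + -1 * p y)
      Q Q0 _ z zP) => [y yP Qy|].
      rewrite PQ // pp qq; apply: (mulIf Qy); rewrite mul0r mulrDl mulrAC divfK //.
      by rewrite mulN1r mulNr -!mevalM -mevalB Z0 meval0.
    apply: (@cdiffD C).
      by apply: (@cdiffM C); [exact: Fhol | exact: dq].
    by apply: (@cdiffM C); [exact: (@cdiff_cst C d (-1)) | exact: dp].
  move/eqP; rewrite mulN1r subr_eq0 => /eqP Fp.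
  by rewrite pq ?q0 // -Fp mulfK ?q0.
apply: contrapT => /eqP Z0; have [x xB] := nonvanishing_point ab (mulf_neq0 Z0 Q0).
rewrite mevalM mulf_eq0 negb_or => /andP[/negP + Qx]; apply; apply/eqP.
rewrite mevalB !mevalM -pp -qq; have xP := bx _ xB; have qx := q0 _ xP.
have := PQ _ xP Qx; rewrite FS // pq // => /eqP; rewrite eqr_div // => /eqP ->.
exact: subrr.
Qed.

End Weak.

(** * Kernels and factors from a pencil *)

(** Cholesky factorization by splitting off the first row and column and recursing on the Schur
    complement of the corner entry. *)
Lemma psd_factor {R : realType} N (A : 'M[R]_N) : real_psd_mx A ->
  exists S : 'M[R]_N, S^T *m S = A.
Proof.
elim: N A => [|N IH] A Ap; first by exists 0; apply/matrixP; case.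
move: A Ap; rewrite -[N.+1]/(1 + N)%N => A Ap.
pose o := lshift N (0 : 'I_1).
pose a := A o o; pose b := dlsubmx A; pose D := drsubmx A.
have ulA : ulsubmx A = a%:M by apply/matrixP => i j; rewrite !ord1 !mxE.
have urA : ursubmx A = b^T by rewrite -[in LHS]Ap.1 trmx_dlsub.
have AE : A = block_mx a%:M b^T b D by rewrite -{1}[A]submxK ulA urA.
pose e : 'cV[R]_(1 + N) := delta_mx o 0.
have eAe : (e^T *m A *m e) 0 0 = a.
  by rewrite trmx_delta -rowE -colE !mxE.
have a0 : 0 <= a by rewrite -eAe; exact: Ap.2.
(* A zero pivot forces a zero column, and then the convention 0^-1 = 0 makes all the formulas below
   correct. *)
have ab0 : a = 0 -> b = 0.
  move=> a_0; rewrite a_0 in eAe; have := psd_mx_null Ap eAe.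
  rewrite -colE => /colP A0; apply/colP => i; rewrite !mxE.
  have := A0 (rshift 1 i); by rewrite !mxE.
have [S SD] : exists S : 'M[R]_N, S^T *m S = D - a^-1 *: (b *m b^T).
  apply: IH; split.
    by rewrite linearB /= linearZ /= trmx_mul trmxK trmx_drsub Ap.1.
  (* With this first coordinate the form of A at v is exactly the form of the Schur complement at
     x. *)
  move=> x; pose v := col_mx (- (a^-1 *: (b^T *m x))) x.
  have Av : A *m v = col_mx 0 ((D - a^-1 *: (b *m b^T)) *m x).
    rewrite AE mul_block_col mul_scalar_mx scalerN scalerA mulmxN mulmxBl.
    rewrite -scalemxAr -scalemxAl mulmxA [in X in col_mx _ X]addrC; congr col_mx.
    have [a_0|a_n0] := eqVneq a 0; last by rewrite divff // scale1r addNr.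
    by rewrite ab0 // trmx0 mul0mx scaler0 oppr0 addr0.
  have := Ap.2 v; rewrite -mulmxA Av tr_col_mx mul_row_col mulmx0 add0r.
  by rewrite mulmxA.
pose s := Num.sqrt a.
have ss : s * s = a by rewrite -expr2 sqr_sqrtr.
exists (block_mx s%:M (s^-1 *: b^T) 0 S).
rewrite tr_block_mx trmx0 tr_scalar_mx linearZ /= trmxK mulmx_block !mulmx0 !mul0mx.
rewrite !addr0 AE -scalar_mxM ss mul_scalar_mx mul_mx_scalar !scalerA.
have sb : (s^-1 * s) *: b = b.
  have [s0|s0] := eqVneq s 0; last by rewrite mulVf // scale1r.
  by rewrite ab0 ?scaler0 // -ss s0 mul0r.
congr block_mx => //.
- by rewrite -[in RHS]sb linearZ /= mulrC.
- by rewrite mulrC sb.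
- by rewrite -scalemxAl -scalemxAr scalerA -invfM ss SD addrC subrK.
Qed.

Section FromPencil.
Context {R : realType} {d n : nat}.
Local Notation C := R[i].
Local Notation cmx := (map_mx (real_complex R)).
Local Notation ones := (const_mx 1 : 'rV[C]_d).

Lemma RB_pencil (f : 'rV[C]_d -> 'M[C]_n) : restriction_of f RB_class ->
  exists m (A : 'I_d -> 'M[R]_(n + m)),
  [/\ forall k, real_psd_mx (A k), \det (drsubmx (mx_pencil A ones)) != 0 &
    forall z, polyhalfplane z -> f z = schur_compl (mx_pencil A z)].
Proof.
move=> [F fF [_ [m [A [Ap [z0 d0] FA]]]]].
have Ad := drsub_det_halfplane Ap d0.
exists m, A; split=> // [|z zP]; first exact/Ad/ones_halfplane.
by rewrite fF // FA // Ad.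
Qed.

Lemma polyhalfplane_Omega (z : 'rV[C]_d) : polyhalfplane z -> Omega z.
Proof.
by move=> zP; exists 1; rewrite normr1; split=> //; exists z; rewrite ?scale1r.
Qed.

Lemma pencil_conj m (A : 'I_d -> 'M[R]_m) z :
  mx_pencil A (map_mx Num.conj z) = map_mx Num.conj (mx_pencil A z).
Proof.
apply/matrixP => i j; rewrite mxE !summxE rmorph_sum; apply: eq_bigr => k _.
by rewrite !mxE rmorphM /= conj_real.
Qed.

Section Pencil.
Variables (m : nat) (A : 'I_d -> 'M[R]_(n + m)).
Hypothesis Ap : forall k, real_psd_mx (A k).
Hypothesis Ad : \det (drsubmx (mx_pencil A ones)) != 0.

Let AdO z : Omega z -> \det (drsubmx (mx_pencil A z)) != 0.
Proof. exact: drsub_det_Omega Ap Ad. Qed.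

Let psi z := schur_vec (mx_pencil A z).

Let psi_conj z : psi (map_mx Num.conj z) = map_mx Num.conj (psi z).
Proof.
rewrite /psi /schur_vec pencil_conj map_col_mx map_mx1 map_mxN map_mxM.
by rewrite map_invmx map_drsubmx map_dlsubmx.
Qed.

Let psiZ z c : Omega z -> c != 0 -> psi (c *: z) = psi z.
Proof.
move=> zO c0; rewrite /psi /schur_vec pencilZ; congr (col_mx _ (- _)).
have -> : drsubmx (c *: mx_pencil A z) = c *: drsubmx (mx_pencil A z).
  by apply/matrixP => i j; rewrite !mxE.
have -> : dlsubmx (c *: mx_pencil A z) = c *: dlsubmx (mx_pencil A z).
  by apply/matrixP => i j; rewrite !mxE.
rewrite invmxZ ?unitfE // -?scalemxAl -?scalemxAr ?scalerA ?mulVf ?scale1r //.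
by rewrite unitmxZ ?unitfE // unitmxE unitfE AdO.
Qed.

(** The sum equals psi(w)^* A(z) psi(z) = psi(w)^* (f(z), 0), and the upper block of psi(w) is the
    identity, so w disappears. Regularity is stated after a polynomial substitution to serve
    phi_k(w) and phi_k(z) in the joint variables. *)
Lemma pencil_factorization : exists (N : 'I_d -> nat)
    (phi : forall k : 'I_d, 'rV[C]_d -> 'M[C]_(N k, n)),
  [/\ forall k D (S : set 'rV[C]_D) (g : 'rV[C]_D -> 'rV[C]_d),
        (forall l, polyfun (fun x => g x 0 l)) ->
        (forall x, S x -> Omega (g x)) ->
        forall i j, regfun S (fun x => phi k (g x) i j),
      forall k z, phi k (map_mx Num.conj z) = map_mx Num.conj (phi k z),
      forall k z (lambda : C), Omega z -> lambda != 0 ->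
        phi k (lambda *: z) = phi k z &
      forall w z, Omega w -> Omega z -> schur_compl (mx_pencil A z)
        = \sum_(k < d) z 0 k *: ((phi k w) ^t* *m phi k z)].
Proof.
have [S SE] := choice (fun k => psd_factor (Ap k)).
exists (fun=> (n + m)%N), (fun k z => cmx (S k) *m psi z); split.
- move=> k D T g pg gT i j; apply: regfun_mulmx => u v.
    exact/regfun_polyfun/polyfun_cst.
  by apply: schur_vec_regfun => // x Tx; exact/AdO/gT.
- by move=> k z; rewrite psi_conj map_mxM conj_cmx.
- by move=> k z c zO c0; rewrite psiZ.
- move=> w z wO zO.
  have E k : (cmx (S k) *m psi w)^t* *m (cmx (S k) *m psi z) =
      (psi w)^t* *m (cmx (A k) *m psi z).
    have SH : (cmx (S k))^t* = cmx (S k)^T.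
      by apply/matrixP => i j; rewrite !mxE conj_real.
    by rewrite trmx_mul map_mxM SH -mulmxA -SE map_mxM -mulmxA.
  under eq_bigr do rewrite E scalemxAr scalemxAl.
  rewrite -mulmx_sumr -mulmx_suml mul_schur_vec ?AdO //.
  rewrite tr_col_mx map_row_mx mul_row_col mulmx0 addr0 trmx1 map_mx1.
  by rewrite mul1mx.
Qed.

End Pencil.

End FromPencil.

(** * The kernel and factor conditions *)

Section AffineSubstitution.
Context {K : numFieldType} {d1 d2 : nat}.

Lemma differentiable_row_mx (a : 'rV[K]_d1) (z : 'rV[K]_d2) :
  differentiable (fun z : 'rV[K]_d2 => row_mx a z : 'rV[K]_(d1 + d2)) z.
Proof.
pose L (z : 'rV[K]_d2) : 'rV[K]_(d1 + d2) := row_mx 0 z.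
have Llin : linear L.
  by move=> c x y; rewrite /L scale_row_mx add_row_mx scaler0 addr0.
pose L' : {linear 'rV[K]_d2 -> 'rV[K]_(d1 + d2)} :=
  HB.pack L (GRing.isLinear.Build _ _ _ _ L Llin).
have Lc : continuous L'.
  move=> y S /nbhs_ballP[e /= e0 eS]; apply/nbhs_ballP; exists e => // x [_ yx].
  apply: eS; split=> // i j; rewrite /= /L.
  by case: (split_ordP j) => k ->; rewrite ?row_mxEl ?row_mxEr //; exact: ballxx.
have -> : (fun z : 'rV[K]_d2 => row_mx a z : 'rV[K]_(d1 + d2)) =
    (fun z => (cst (row_mx a 0) : 'rV[K]_d2 -> _) z + L' z).
  by apply/funext => x; rewrite /= /L add_row_mx addr0 add0r.
by apply: differentiableD; [exact: differentiable_cst|exact: linear_differentiable].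
Qed.

Lemma cdiff_row_mx (G : 'rV[K]_(d1 + d2) -> K) a z :
  cdiff G (row_mx a z) -> cdiff (fun z => G (row_mx a z)) z.
Proof.
by move=> dG; apply: differentiable_comp dG; exact: differentiable_row_mx.
Qed.

End AffineSubstitution.

Section RationalFunctions.
Context {R : realType} {d : nat}.
Local Notation C := R[i].
Variable S : set 'rV[C]_d.

(** The scalar form of [rational_on]; unlike for [regfun], the denominator may have zeros in S. *)
Definition ratfun (g : 'rV[C]_d -> C) := exists P Q : mpoly d C, Q != 0 /\
  forall z, S z -> meval (z 0) Q != 0 -> g z = meval (z 0) P / meval (z 0) Q.

Lemma ratfunD g h : ratfun g -> ratfun h -> ratfun (fun z => g z + h z).
Proof.
move=> [P [Q [Q0 gE]]] [P' [Q' [Q'0 hE]]].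
exists (P * Q' + P' * Q), (Q * Q'); split; first by rewrite mulf_neq0.
move=> z Sz; rewrite mevalM mulf_eq0 negb_or => /andP[Qz Q'z].
by rewrite gE // hE // mevalD !mevalM addf_div.
Qed.

Lemma ratfunM g h : ratfun g -> ratfun h -> ratfun (fun z => g z * h z).
Proof.
move=> [P [Q [Q0 gE]]] [P' [Q' [Q'0 hE]]].
exists (P * P'), (Q * Q'); split; first by rewrite mulf_neq0.
move=> z Sz; rewrite mevalM mulf_eq0 negb_or => /andP[Qz Q'z].
by rewrite gE // hE // !mevalM mulf_div.
Qed.

Lemma polyfun_ratfun g : polyfun g -> ratfun g.
Proof.
move=> [[P gP] _]; exists P, 1; split; first exact: oner_neq0.
by move=> z _ _; rewrite meval1 divr1.
Qed.

Lemma eq_ratfun g h : g =1 h -> ratfun g -> ratfun h.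
Proof. by move=> /funext ->. Qed.

Lemma ratfun_sum I (r : seq I) (g : I -> 'rV[C]_d -> C) :
  (forall i, ratfun (g i)) -> ratfun (fun z => \sum_(i <- r) g i z).
Proof.
move=> rg; elim: r => [|i r IH].
  by apply: eq_ratfun (polyfun_ratfun (polyfun_cst 0)) => z; rewrite big_nil.
by apply: eq_ratfun (ratfunD (rg i) IH) => z; rewrite big_cons.
Qed.

Lemma cdiff_sum I (r : seq I) (g : I -> 'rV[C]_d -> C) (z : 'rV[C]_d) :
  (forall i, @cdiff C d (g i) z) -> @cdiff C d (fun z => \sum_(i <- r) g i z) z.
Proof.
move=> dg; elim: r => [|i r IH].
  rewrite (_ : (fun z => _) = (fun=> 0)); first exact: (@cdiff_cst C).
  by apply/funext => x; rewrite big_nil.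
rewrite (_ : (fun z => _) = (fun z => g i z + \sum_(i <- r) g i z)).
  exact: (@cdiffD C).
by apply/funext => x; rewrite big_cons.
Qed.

End RationalFunctions.

Section KernelConditions.
Context {R : realType} {d n : nat}.
Local Notation C := R[i].
Local Notation cmx := (map_mx (real_complex R)).
Local Notation ones := (const_mx 1 : 'rV[C]_d).
Implicit Type f : 'rV[C]_d -> 'M[C]_n.

Lemma regfun_rational_holomorphic D p q (S : set 'rV[C]_D)
    (G : 'rV[C]_D -> 'M[C]_(p, q)) : S !=set0 ->
  (forall i j, regfun S (fun x => G x i j)) ->
  rational_on S G /\ holomorphic_on S G.
Proof.
move=> S0 rG; split=> [i j|i j z Sz]; last exact: (regfun_differentiable (rG i j)).
have [P [Q [Q0 PQ]]] := regfun_rational S0 (rG i j).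
by exists P, Q; split=> // z _; exact: PQ.
Qed.

Definition kernel_condition (F : 'rV[C]_d -> 'M[C]_n) :=
  exists Phi : 'I_d -> 'rV[C]_d -> 'rV[C]_d -> 'M[C]_n,
  [/\ forall k, rational_on Omega2 (conj_left (Phi k)) /\
                holomorphic_on Omega2 (conj_left (Phi k)),
      forall k w z, Omega w -> Omega z ->
        Phi k (map_mx Num.conj w) (map_mx Num.conj z)
          = map_mx Num.conj (Phi k w z),
      forall k, positive_kernel Omega (Phi k),
      forall k w z (lambda : C), Omega w -> Omega z -> lambda != 0 ->
        Phi k (lambda *: w) (lambda *: z) = Phi k w z &
      forall w z, Omega w -> Omega z ->
        F z = \sum_(k < d) z 0 k *: Phi k w z].

Definition factor_condition (F : 'rV[C]_d -> 'M[C]_n) :=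
  exists (N : 'I_d -> nat)
    (phi : forall k : 'I_d, 'rV[C]_d -> 'M[C]_(N k, n)),
  [/\ forall k, rational_on Omega (phi k) /\ holomorphic_on Omega (phi k),
      forall k, real_on Omega (phi k),
      forall k z (lambda : C), Omega z -> lambda != 0 ->
        phi k (lambda *: z) = phi k z &
      forall w z, Omega w -> Omega z ->
        F z = \sum_(k < d) z 0 k *: ((phi k w) ^t* *m phi k z)].

Lemma ones_Omega : Omega ones.
Proof. exact/polyhalfplane_Omega/ones_halfplane. Qed.

Lemma RB_factor f : restriction_of f RB_class -> restriction_of f factor_condition.
Proof.
move=> /RB_pencil[m [A [Ap Ad fA]]].
exists (fun z => schur_compl (mx_pencil A z)) => //.
have [N [phi [rphi cphi hphi sphi]]] := pencil_factorization Ap Ad.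
exists N, phi; split=> // k; last by move=> z _; exact: cphi.
apply: regfun_rational_holomorphic; first by exists ones; exact: ones_Omega.
by apply: (rphi k d Omega id) => // l; exact: polyfun_coord.
Qed.

Lemma gram_positive_kernel N (L : set 'rV[C]_d) (phi : 'rV[C]_d -> 'M[C]_(N, n)) :
  positive_kernel L (fun w z => (phi w)^t* *m phi z).
Proof.
move=> M l u _.
have -> : \sum_i \sum_j cdot ((phi (l i))^t* *m phi (l j) *m u j) (u i) =
    cdot (\sum_j phi (l j) *m u j) (\sum_j phi (l j) *m u j).
  pose s := \sum_j phi (l j) *m u j; rewrite /cdot -/s.
  have -> : s^t* = \sum_i (phi (l i) *m u i)^t* by rewrite !raddf_sum.
  rewrite mulmx_suml summxE; apply: eq_bigr => i _.
  rewrite mulmx_sumr summxE; apply: eq_bigr => j _.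
  by rewrite trmx_mul map_mxM !mulmxA.
rewrite cdotE; apply: sumr_ge0 => k _.
by rewrite mulrC -normCK exprn_ge0.
Qed.

Lemma RB_kernel f : restriction_of f RB_class -> restriction_of f kernel_condition.
Proof.
move=> /RB_pencil[m [A [Ap Ad fA]]].
exists (fun z => schur_compl (mx_pencil A z)) => //.
have [N [phi [rphi cphi hphi sphi]]] := pencil_factorization Ap Ad.
exists (fun k w z => (phi k w)^t* *m phi k z); split.
- move=> k; apply: regfun_rational_holomorphic.
    exists (row_mx ones ones); rewrite /Omega2 /= row_mxKl row_mxKr.
    by split; exact: ones_Omega.
  move=> i j.
  (* As phi_k is real, phi_k(conj u)^* is the transpose of phi_k(u), and no conjugation is left in
     the variables (conj w, z). *)
  apply: (@eq_regfun _ _ _ (fun x => ((phi k (lsubmx x))^T *m phi k (rsubmx x)) i j)).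
    move=> x; rewrite /conj_left cphi; congr ((_ *m _) i j).
    by apply/matrixP => u v; rewrite !mxE conjCK.
  apply: regfun_mulmx => u v.
    apply: (@eq_regfun _ _ _ (fun x => phi k (lsubmx x) v u)).
      by move=> x; rewrite mxE.
    apply: rphi => [l|x []] //.
    apply: eq_polyfun (polyfun_coord (lshift d l)) => x; by rewrite mxE.
  apply: rphi => [l|x []] //.
  apply: eq_polyfun (polyfun_coord (rshift d l)) => x; by rewrite mxE.
- move=> k w z _ _; rewrite !cphi map_mxM; congr (_ *m _).
  by apply/matrixP => u v; rewrite !mxE.
- by move=> k; exact: gram_positive_kernel.
- by move=> k w z c wO zO c0; rewrite !hphi.
- exact: sphi.
Qed.

Lemma conj_positive_reals z : positive_reals z -> map_mx Num.conj z = z :> 'rV[C]_d.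
Proof. by case=> x _ ->; rewrite conj_cmx. Qed.

Lemma positive_reals_Omega z : positive_reals z -> Omega (z : 'rV[C]_d).
Proof.
by case=> x x0 ->; apply: polyhalfplane_Omega; exact: cmx_polyhalfplane.
Qed.

Lemma restriction_RB f F : (forall z, polyhalfplane z -> f z = F z) ->
  restriction_of F RB_class -> restriction_of f RB_class.
Proof. by move=> fF [G FG RG]; exists G => // z zP; rewrite fF ?FG. Qed.

(* Freezing the first argument of the kernels at w0 shows that F is rational and
   holomorphic. *)
Lemma frozen_RB f (F : 'rV[C]_d -> 'M[C]_n)
    (Phi : 'I_d -> 'rV[C]_d -> 'rV[C]_d -> 'M[C]_n) w0 :
  (forall z, polyhalfplane z -> f z = F z) ->
  Omega w0 ->
  (forall k i j, ratfun polyhalfplane (fun z => Phi k w0 z i j)) ->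
  (forall k i j z, polyhalfplane z -> @cdiff C d (fun z => Phi k w0 z i j) z) ->
  (forall k, positive_kernel positive_reals (Phi k)) ->
  (forall k w z, positive_reals w -> positive_reals z ->
     map_mx Num.conj (Phi k w z) = Phi k w z) ->
  (forall w z, Omega w -> Omega z -> F z = \sum_k z 0 k *: Phi k w z) ->
  restriction_of f RB_class.
Proof.
move=> fF w0O rP dP pP cP sP.
pose F' (z : 'rV[C]_d) := \sum_k z 0 k *: Phi k w0 z.
have F'E i j : (fun z => F' z i j) = (fun z : 'rV[C]_d => \sum_k z 0 k * Phi k w0 z i j).
  by apply/funext => z; rewrite summxE; apply: eq_bigr => k _; rewrite mxE.
apply: (@restriction_RB f F').
  by move=> z zP; rewrite fF // (sP w0) //; exact: polyhalfplane_Omega.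
apply: (@weak_realization R d n F' Phi) => //.
- move=> i j; suff : ratfun polyhalfplane (fun z => F' z i j) by [].
  rewrite F'E; apply: ratfun_sum => k; apply: ratfunM => //.
  exact/polyfun_ratfun/polyfun_coord.
- move=> i j z zP; suff : @cdiff C d (fun z => F' z i j) z by [].
  rewrite F'E; apply: cdiff_sum => k; apply: (@cdiffM C); first exact: (@cdiff_coord C).
  exact: dP.
- move=> w z /positive_reals_Omega wO /positive_reals_Omega zO.
  by rewrite -(sP w z wO zO) (sP w0 z w0O zO).
Qed.

Lemma factor_RB f : restriction_of f factor_condition -> restriction_of f RB_class.
Proof.
move=> [F fF [N [phi [rphi cphi hphi sphi]]]].
pose Phi k w z := (phi k w)^t* *m phi k z.
have PhiE k w i j : (fun z => Phi k w z i j) =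
    (fun z => \sum_u Num.conj (phi k w u i) * phi k z u j).
  apply/funext => z; rewrite mxE; apply: eq_bigr => u _; by rewrite !mxE.
apply: (@frozen_RB f F Phi ones) => //.
- exact: ones_Omega.
- move=> k i j; rewrite PhiE; apply: ratfun_sum => u; apply: ratfunM.
    exact/polyfun_ratfun/polyfun_cst.
  have [P [Q [Q0 PQ]]] := (rphi k).1 u j; exists P, Q; split=> // z zP.
  by apply: PQ; exact: polyhalfplane_Omega.
- move=> k i j z zP; rewrite PhiE; apply: cdiff_sum => u.
  apply: (@cdiffM C); first exact: (@cdiff_cst C).
  by apply: (rphi k).2; exact: polyhalfplane_Omega.
- by move=> k; exact: gram_positive_kernel.
- move=> k w z wP zP; rewrite /Phi map_mxM.
  have cc v : positive_reals v -> map_mx Num.conj (phi k v) = phi k v.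
    move=> vP; rewrite -(cphi k v (positive_reals_Omega vP)).
    by rewrite conj_positive_reals.
  rewrite (cc z) //; congr (_ *m _); apply/matrixP => u v; rewrite !mxE.
  by have /matrixP/(_ v u) := cc w wP; rewrite !mxE => e; rewrite !e.
Qed.

(** Freezing w could turn a denominator in (conj w, z) into the zero polynomial of z. A positive
    real point (a, b) at which the product of all denominators is nonzero gives a safe value a,
    equal to its own conjugate. *)
Lemma kernel_RB f : restriction_of f kernel_condition -> restriction_of f RB_class.
Proof.
move=> [F fF [Phi [rPhi cPhi pPhi hPhi sPhi]]].
have [P PP] := choice (fun t : 'I_d * 'I_n * 'I_n => (rPhi t.1.1).1 t.1.2 t.2).
have [Q PQ] := choice PP; pose QQ := \prod_t Q t.
have QQ0 : QQ != 0 by apply/prodf_neq0 => t _; exact: (PQ t).1.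
have [x xB Qx] := @nonvanishing_point R (d + d) QQ (fun=> 0) (fun=> 1) (fun=> ltr01) QQ0.
pose a : 'rV[C]_d := cmx (lsubmx x); pose b : 'rV[C]_d := cmx (rsubmx x).
have aP : positive_reals a.
  by exists (lsubmx x) => // k; rewrite mxE; have /andP[] := xB (lshift d k).
have aE : map_mx Num.conj a = a by exact: conj_positive_reals.
have PhiE k z : Phi k a z = conj_left (Phi k) (row_mx a z).
  by rewrite /conj_left row_mxKl row_mxKr aE.
have aO := positive_reals_Omega aP.
apply: (@frozen_RB f F Phi a) => //.
- move=> k i j.
  (* Substitutes the coordinates of a for the first d variables; b witnesses that the resulting
     denominators are nonzero. *)
  pose lq := [tuple match fintype.split l with inl u => mpolyC d (a 0 u)
                    | inr u => mpolyX C (mnm1 u) end | l < d + d].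
  have lqE (T : mpoly (d + d) C) (z : 'rV[C]_d) :
      meval (z 0) (comp_mpoly lq T) = meval (row_mx a z 0) T.
    rewrite comp_mpoly_meval; apply: meval_eq => l; rewrite tnth_mktuple mxE.
    by case: fintype.split => u; rewrite ?mevalC ?mevalXU.
  exists (comp_mpoly lq (P (k, i, j))), (comp_mpoly lq (Q (k, i, j))); split.
    apply: contraNneq Qx => Q0.
    have := lqE (Q (k, i, j)) b; rewrite Q0 meval0 /a /b -map_row_mx hsubmxK => Qx.
    by rewrite /QQ rmorph_prod (bigD1 (k, i, j)) //= -Qx mul0r.
  move=> z zP; rewrite !lqE => Qz; rewrite PhiE (PQ (k, i, j)).2 //.
  rewrite /Omega2 /= row_mxKl row_mxKr; split=> //; exact: polyhalfplane_Omega.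
- move=> k i j z zP.
  rewrite (_ : (fun z => Phi k a z i j) =
      (fun z => conj_left (Phi k) (row_mx a z) i j)); last first.
    by apply/funext => y; rewrite PhiE.
  apply: (@cdiff_row_mx C d d (fun x => conj_left (Phi k) x i j) a z).
  apply: (rPhi k).2.
  rewrite /Omega2 /= row_mxKl row_mxKr; split=> //; exact: polyhalfplane_Omega.
- by move=> k N l u lP; apply: pPhi => i; exact/positive_reals_Omega/lP.
- move=> k w z wP zP; rewrite -cPhi ?conj_positive_reals //;
  exact: positive_reals_Omega.
Qed.

End KernelConditions.

(** * Transfer functions *)

Section CayleyPoints.
Context {R : realType} {d : nat}.
Local Notation C := R[i].

Lemma polydisk_neq1 (c : C) : `|c| < 1 -> 1 - c != 0.
Proof.
by apply: contraTneq => /subr0_eq <-; rewrite normr1 ltxx.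
Qed.

Lemma normC_lt1 (c : C) : (`|c| < 1) = (complex.Re c ^+ 2 + complex.Im c ^+ 2 < 1).
Proof.
by rewrite -(@expr_lt1 _ 2) ?normr_ge0 // -add_Re2_Im2 ltcR.
Qed.

Lemma cayley_halfplane (zeta : 'rV[C]_d) :
  polydisk zeta -> polyhalfplane (cayley_point zeta).
Proof.
move=> zD k; rewrite mxE; have := zD k; have := polydisk_neq1 (zD k).
rewrite normC_lt1; case: (zeta 0 k) => x y /=.
rewrite eq_complex /= negb_and => n0 lt1.
have s0 : 0 < (1 - x) ^+ 2 + (0 - y) ^+ 2.
  rewrite lt_def addr_ge0 ?sqr_ge0 // andbT paddr_eq0 ?sqr_ge0 // !sqrf_eq0.
  by rewrite negb_and.
rewrite [X in 0 < X](_ : _ = (1 - (x ^+ 2 + y ^+ 2)) / ((1 - x) ^+ 2 + (0 - y) ^+ 2)).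
  by rewrite divr_gt0 // subr_gt0.
by field; rewrite -[- y]sub0r; exact: lt0r_neq0.
Qed.

Lemma cayley_surj (z : 'rV[C]_d) : polyhalfplane z ->
  exists2 zeta : 'rV[C]_d, polydisk zeta & cayley_point zeta = z.
Proof.
move=> zP; have z1 k : z 0 k + 1 != 0.
  apply/eqP => /eqP; rewrite addr_eq0 => /eqP zk; have := zP k.
  by rewrite zk /=; lra.
exists (\row_k ((z 0 k - 1) / (z 0 k + 1))).
  move=> k; rewrite mxE normf_div ltr_pdivrMr ?normr_gt0 // mul1r.
  rewrite -(@ltr_pXn2r _ 2) ?nnegrE ?normr_ge0 // -!add_Re2_Im2 ltcR.
  by have := zP k; case: (z 0 k) => x y /= x0; rewrite -subr_gt0; nra.
apply/rowP => k; rewrite !mxE; field; rewrite z1 /=.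
by rewrite (_ : _ - _ = 2) ?pnatr_eq0 //; ring.
Qed.

End CayleyPoints.

Section MixedBlocks.
Context {R : realType} {d : nat} (m_ : 'I_d -> nat).
Local Notation C := R[i].
Local Notation cmx := (map_mx (real_complex R)).

Lemma pencil_of_blocks p (S : forall k, 'M[R]_(m_ k, p)) (z : 'rV[C]_d) :
  (cmx (\mxcol_k S k))^T *m diag_P m_ z *m cmx (\mxcol_k S k) =
  mx_pencil (fun k => (S k)^T *m S k) z.
Proof.
have cS : cmx (\mxcol_k S k) = \mxcol_k cmx (S k).
  by apply/matrixP => i j; rewrite !mxE.
rewrite cS tr_mxcol mul_mxrow_mxdiag mul_mxrow_mxcol; apply: eq_bigr => k _.
rewrite mul_mx_scalar -scalemxAl map_mxM; congr (_ *: (_ *m _)).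
by apply/matrixP => i j; rewrite !mxE.
Qed.

Lemma diag_PE (zeta : 'rV[C]_d) :
  diag_P m_ zeta = diag_mx (\row_i zeta 0 (tagnat.sig1 i)).
Proof.
have -> : (\row_i zeta 0 (tagnat.sig1 i)) =
    \mxrow_k (const_mx (zeta 0 k) : 'rV[C]_(m_ k)).
  by apply/rowP => i; rewrite !mxE.
by rewrite diag_mxrow; apply/eq_mxdiag => k; rewrite diag_const_mx.
Qed.

Lemma diag_PM (u v w : 'rV[C]_d) : (forall k, u 0 k * v 0 k = w 0 k) ->
  diag_P m_ u *m diag_P m_ v = diag_P m_ w.
Proof.
move=> uvw; rewrite !diag_PE mulmx_diag; congr diag_mx.
by apply/rowP => i; rewrite !mxE uvw.
Qed.

Lemma diag_PD (u v w : 'rV[C]_d) : (forall k, u 0 k + v 0 k = w 0 k) ->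
  diag_P m_ u + diag_P m_ v = diag_P m_ w.
Proof.
by move=> uvw; rewrite -mxdiagD; apply: eq_mxdiag => k; rewrite -raddfD uvw.
Qed.

Lemma diag_P1 : diag_P m_ (const_mx 1 : 'rV[C]_d) = 1%:M.
Proof. by rewrite -mxdiagZ; apply: eq_mxdiag => k; rewrite mxE. Qed.

Lemma diag_P_contraction (zeta : 'rV[C]_d) (v : 'rV[C]_(\sum_k m_ k)) :
  polydisk zeta ->
  \sum_i `|v 0 i| ^+ 2 <= \sum_i `|(v *m diag_P m_ zeta) 0 i| ^+ 2 -> v = 0.
Proof.
move=> zD; rewrite -subr_ge0 -sumrB => vle.
have zlt i : 0 < 1 - `|zeta 0 i| ^+ 2 by rewrite subr_gt0 expr_lt1 ?zD.
have E i : `|(v *m diag_P m_ zeta) 0 i| ^+ 2 - `|v 0 i| ^+ 2 =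
    - ((1 - `|zeta 0 (tagnat.sig1 i)| ^+ 2) * `|v 0 i| ^+ 2).
  by rewrite diag_PE mul_mx_diag !mxE normrM exprMn; ring.
move: vle; rewrite (eq_bigr _ (fun i _ => E i)).
rewrite sumrN oppr_ge0 => vle.
have t0 i : 0 <= (1 - `|zeta 0 (tagnat.sig1 i)| ^+ 2) * `|v 0 i| ^+ 2.
  by rewrite mulr_ge0 ?exprn_ge0 // ltW.
have s0 : \sum_i (1 - `|zeta 0 (tagnat.sig1 i)| ^+ 2) * `|v 0 i| ^+ 2 = 0.
  by apply/le_anti; rewrite vle sumr_ge0.
have v0 := psumr_eq0P (fun i _ => t0 i) s0.
apply/rowP => i; have /eqP := v0 i isT.
by rewrite mulf_eq0 gt_eqF //= expf_eq0 normr_eq0 mxE => /eqP.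
Qed.

Variables (n : nat) (U : 'M[R]_(\sum_k m_ k + n)).
Hypothesis Uorth : U *m U^T = 1%:M.

(** A left null vector satisfies v = v P A. Since U is orthogonal its corner A does not increase
    norms, so |v| <= |v P|, whereas P contracts strictly on the polydisk. *)
Lemma resolvent_unit (zeta : 'rV[C]_d) : polydisk zeta ->
  1%:M - diag_P m_ zeta *m ulsubmx (cmx U) \in unitmx.
Proof.
move=> zD; rewrite unitmxE unitfE; apply/negP => /det0P[v v0].
rewrite mulmxBr mulmx1 => /eqP; rewrite subr_eq0 => /eqP vE.
case/eqP: v0; apply: (diag_P_contraction zD); set w := v *m diag_P m_ zeta.
have nrmE p (x : 'rV[C]_p) : \sum_i `|x 0 i| ^+ 2 = (x *m x^t*) 0 0.
  by rewrite mxE; apply: eq_bigr => i _; rewrite !mxE normCK.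
have UU : cmx U *m (cmx U)^t* = 1%:M.
  have -> : (cmx U)^t* = cmx U^T by apply/matrixP => i j; rewrite !mxE conj_real.
  by rewrite -map_mxM Uorth map_mx1.
have : \sum_i `|row_mx w (0 : 'rV_n) 0 i| ^+ 2 = \sum_i `|(row_mx w 0 *m cmx U) 0 i| ^+ 2.
  by rewrite !nrmE trmx_mul map_mxM mulmxA -(mulmxA (row_mx w 0)) UU mulmx1.
have -> : row_mx w 0 *m cmx U =
    row_mx (w *m ulsubmx (cmx U)) (w *m ursubmx (cmx U)).
  by rewrite -{1}[cmx U]submxK mul_row_block !mul0mx !addr0.
rewrite !big_split_ord /=.
rewrite [X in _ + X]big1; last by move=> i _; rewrite row_mxEr mxE normr0 expr0n.
rewrite addr0 (eq_bigr (fun i => `|w 0 i| ^+ 2)); last first.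
  by move=> i _; rewrite row_mxEl.
move=> ->; rewrite [X in _ <= X + _](eq_bigr (fun i => `|v 0 i| ^+ 2)).
  by rewrite lerDl sumr_ge0 // => i _; exact: exprn_ge0.
by move=> i _; rewrite row_mxEl /w -mulmxA -vE.
Qed.

End MixedBlocks.

Section TransferRealization.
Context {R : realType} {d n : nat}.
Local Notation C := R[i].
Local Notation cmx := (map_mx (real_complex R)).
Local Notation ones := (const_mx 1 : 'rV[C]_d).

Definition transfer_condition (f : 'rV[C]_d -> 'M[C]_n) :=
  (forall z, polyhalfplane z -> f z + 1%:M \in unitmx) /\
  exists (m_ : 'I_d -> nat) (U : 'M[R]_(\sum_k m_ k + n)),
    [/\ U^T = U, U *m U^T = 1%:M,
        forall zeta, polydisk zeta ->
          1%:M - diag_P m_ zeta *m ulsubmx (map_mx (real_complex R) U)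
            \in unitmx /\
          double_cayley f zeta = transfer_function U (diag_P m_ zeta) &
        ~~ eigenvalue (double_cayley f 0) 1].

(** If f v = -v, the vector y = psi v has y^* A(z) y = -|v|^2, so every A_k annihilates y; but A(z)
    y = (-v, 0). *)
Lemma RB_add1_unit m (A : 'I_d -> 'M[R]_(n + m)) z :
  (forall k, real_psd_mx (A k)) -> \det (drsubmx (mx_pencil A z)) != 0 ->
  polyhalfplane z -> schur_compl (mx_pencil A z) + 1%:M \in unitmx.
Proof.
move=> Ap d0 zP; rewrite unitmxE unitfE -det_tr; apply/negP => /det0P[v v0 vf].
have fv : schur_compl (mx_pencil A z) *m v^T = - v^T.
  apply/eqP; rewrite -addr_eq0 -{2}[v^T]mul1mx -mulmxDl.
  by rewrite -[X in X *m _]trmxK -trmx_mul vf trmx0.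
set y := schur_vec (mx_pencil A z) *m v^T.
have Ay : mx_pencil A z *m y = col_mx (- v^T) 0.
  by rewrite /y mulmxA mul_schur_vec // mul_col_mx fv mul0mx.
have y0 : forall k, cmx (A k) *m y = 0.
  apply: (pencil_null Ap zP) => j; rewrite ord1 -mulmxA Ay /y mul_col_mx mul1mx.
  rewrite tr_col_mx map_row_mx mul_row_col mulmx0 addr0 mulmxN !mxE raddfN oppr_le0.
  rewrite raddf_sum; apply: sumr_ge0 => i _; rewrite !mxE mulrC -normCK.
  by apply: Re_ge0; exact: exprn_ge0.
case/eqP: v0; apply: trmx_inj; apply/eqP; rewrite trmx0 -oppr_eq0; apply/eqP.
have : mx_pencil A z *m y = 0.
  by rewrite mulmx_suml big1 // => k _; rewrite -scalemxAl y0 scaler0.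
by rewrite Ay => /eqP; rewrite col_mx_eq0 => /andP[/eqP].
Qed.

(* The eigenvectors (-Q, 1) and (ZQ, f) of U for -1 and 1 add up to the system
   equations of U. *)
Lemma transfer_function_cayley M (U : 'M[R]_(M + n)) (P Z : 'M[C]_M)
    (Q : 'M[C]_(M, n)) (f : 'M[C]_n) :
  P *m (Z + 1%:M) = Z - 1%:M ->
  1%:M - P *m ulsubmx (cmx U) \in unitmx -> f + 1%:M \in unitmx ->
  cmx U *m col_mx (- Q) 1%:M = - col_mx (- Q) 1%:M ->
  cmx U *m col_mx (Z *m Q) f = col_mx (Z *m Q) f ->
  (f - 1%:M) *m invmx (f + 1%:M) = transfer_function U P.
Proof.
move=> PZ Pu fu Um Up; rewrite /transfer_function.
set A := ulsubmx _ in Pu *; set B := ursubmx _; set D := drsubmx _; set E := dlsubmx _.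
pose th := (Z + 1%:M) *m Q.
have Pth : P *m th = (Z - 1%:M) *m Q by rewrite mulmxA PZ.
have : cmx U *m col_mx (P *m th) (f + 1%:M) = col_mx th (f - 1%:M).
  have -> : col_mx (P *m th) (f + 1%:M) = col_mx (Z *m Q) f + col_mx (- Q) 1%:M.
    by rewrite add_col_mx Pth mulmxBl mul1mx.
  rewrite mulmxDr Um Up opp_col_mx add_col_mx opprK /th mulmxDl mul1mx.
  by [].
rewrite -[cmx U]submxK mul_block_col -/A -/B -/D -/E => /eq_col_mx[eA eE].
have PE : P *m th = invmx (1%:M - P *m A) *m P *m B *m (f + 1%:M).
  have : (1%:M - P *m A) *m (P *m th) = P *m B *m (f + 1%:M).
    rewrite mulmxBl mul1mx -{1}eA mulmxDr !mulmxA addrC.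
    by rewrite addKr.
  by move=> /(congr1 (mulmx (invmx (1%:M - P *m A)))); rewrite mulKmx // !mulmxA.
by rewrite -eE PE !mulmxA -mulmxDl mulmxK // addrC.
Qed.

Lemma RB_transfer f : restriction_of f RB_class -> transfer_condition f.
Proof.
move=> /RB_pencil[m [A [Ap Ad fA]]].
have AdP := drsub_det_halfplane Ap Ad.
have fu z : polyhalfplane z -> f z + 1%:M \in unitmx.
  by move=> zP; rewrite fA //; apply: RB_add1_unit => //; exact: AdP.
split=> //.
have [S SE] := choice (fun k => psd_factor (Ap k)).
pose m_ (k : 'I_d) := (n + m)%N.
pose SS : 'M[R]_(\sum_k m_ k, n + m) := \mxcol_k (S k : 'M[R]_(m_ k, n + m)).
pose T : 'M[R]_(\sum_k m_ k + n, n + m) := col_mx (- SS) (row_mx 1%:M 0).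
pose H := T^T *m T.
have SSE z : (cmx SS)^T *m diag_P m_ z *m cmx SS = mx_pencil A z.
  by rewrite pencil_of_blocks; apply: eq_bigr => k _; rewrite SE.
(* T is injective: T v = 0 kills the first block of v and gives S v = 0, and A_22(1, ..., 1), being
   invertible, kills the second. *)
have Hu : H \in unitmx.
  rewrite unitmxE unitfE; apply/negP => /det0P[v v0 vH].
  have Tv : T *m v^T = 0.
    apply: mx_normal_null_real; rewrite trmx_mul trmxK mulmxA -(mulmxA v) vH.
    by rewrite mul0mx.
  case/eqP: v0; apply: trmx_inj; rewrite trmx0.
  move: Tv; rewrite mul_col_mx => /eqP; rewrite col_mx_eq0 mulNmx oppr_eq0.
  rewrite -[v^T]vsubmxK mul_row_col mul1mx mul0mx addr0 => /andP[/eqP Sv /eqP v1].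
  rewrite v1 in Sv *; suff -> : dsubmx v^T = 0 by rewrite col_mx0.
  have : mx_pencil A ones *m cmx (col_mx 0 (dsubmx v^T)) = 0.
    by rewrite -SSE diag_P1 mulmx1 -mulmxA -map_mxM Sv map_mx0 mulmx0.
  rewrite -{1}[mx_pencil A ones]submxK map_col_mx map_mx0 mul_block_col !mulmx0.
  rewrite !add0r => /eqP; rewrite col_mx_eq0 => /andP[_ /eqP].
  move/(congr1 (mulmx (invmx (drsubmx (mx_pencil A ones))))).
  rewrite mulKmx ?unitmxE ?unitfE // mulmx0 -(map_mx0 (real_complex R)).
  exact: map_mx_inj.
pose U : 'M[R]_(\sum_k m_ k + n) := 1%:M - 2 *: (T *m invmx H *m T^T).
have Hs : (invmx H)^T = invmx H by rewrite trmx_inv /H trmx_mul trmxK.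
have Us : U^T = U.
  by rewrite linearB /= trmx1 linearZ /= !trmx_mul trmxK Hs mulmxA.
have UT : U *m T = - T.
  rewrite mulmxBl mul1mx -scalemxAl -!mulmxA -/H mulVmx // mulmx1.
  by rewrite scaler_nat mulr2n opprD addrA subrr add0r.
have TU : T^T *m U = - T^T by rewrite -[U in LHS]Us -trmx_mul UT linearN.
have UU : U *m U = 1%:M.
  rewrite {2}/U mulmxBr mulmx1 -scalemxAr !mulmxA UT mulNmx mulNmx scalerN opprK.
  by rewrite subrK.
exists m_, U; split=> //; first by rewrite Us.
  move=> zeta zD; set z := cayley_point zeta.
  have zP : polyhalfplane z by exact: cayley_halfplane.
  have PA := resolvent_unit (etrans (congr1 (mulmx U) Us) UU) zD.
  split=> //; rewrite /double_cayley -/z.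
  pose psi := schur_vec (mx_pencil A z).
  apply: (@transfer_function_cayley _ _ _ (diag_P m_ z) (cmx SS *m psi)) => //.
  - pose w : 'rV[C]_d := \row_k (z 0 k - 1).
    have wE : diag_P m_ z = diag_P m_ w + 1%:M.
      by rewrite -diag_P1; apply/esym/diag_PD => k; rewrite !mxE subrK.
    rewrite {2}wE addrK -diag_P1 (@diag_PD _ _ _ _ _ (\row_k (z 0 k + 1))).
      apply: diag_PM => k; rewrite !mxE; field; exact: polydisk_neq1.
    by move=> k; rewrite !mxE.
  - exact: fu.
  - have -> : col_mx (- (cmx SS *m psi)) 1%:M = cmx T *m psi.
      rewrite map_col_mx mul_col_mx map_mxN mulNmx map_row_mx map_mx0 map_mx1.
      by rewrite mul_row_col mulmx1 mul0mx addr0.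
    by rewrite mulmxA -map_mxM UT map_mxN mulNmx.
  (* This vector is orthogonal to the range of T: T^T y = -S^T Z S psi + (f, 0) = -A(z) psi + (f, 0)
     = 0. So the reflection fixes it. *)
  - set y := col_mx _ _.
    have Ty : cmx T^T *m y = 0.
      rewrite -map_trmx map_col_mx tr_col_mx mul_row_col map_mxN raddfN /= mulNmx.
      rewrite !mulmxA SSE mul_schur_vec ?AdP // map_row_mx tr_row_mx map_mx0 map_mx1.
      rewrite trmx1 trmx0 mul_col_mx mul1mx mul0mx fA // opp_col_mx add_col_mx.
      by rewrite oppr0 addr0 addNr col_mx0.
    rewrite map_mxB map_mx1 map_mxZ mulmxBl mul1mx -scalemxAl map_mxM -mulmxA Ty.
    by rewrite mulmx0 scaler0 subr0.
(* An eigenvector for 1 would satisfy v (f - 1) = v (f + 1) at the point (1, ..., 1), whence v =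
   -v. *)
apply/negP => /eigenvalueP[v]; rewrite scale1r => vE; case/negP; apply/eqP.
have e0 : cayley_point (0 : 'rV[C]_d) = ones.
  by apply/rowP => k; rewrite !mxE subr0 addr0 divr1.
move: vE; rewrite /double_cayley e0 => /(congr1 (mulmx^~ (f ones + 1%:M))) /=.
rewrite -!mulmxA mulVmx ?fu //; last exact: ones_halfplane.
rewrite mulmx1 mulmxDr mulmxDr mulmxN mulmx1.
move=> /addrI /rowP vN; apply/rowP => j; have /eqP := vN j.
by rewrite !mxE eqNr => /eqP.
Qed.

(** N = (1 - U)/2 is the orthogonal projection on the eigenspace for -1. Each z yields a block (-W,
    1) in that space and a block (Z W, f(z)) orthogonal to it; with T inside the space and ending in
    the rows (1 0), this orthogonality is the pencil equation. *)
Lemma transfer_RB f : transfer_condition f -> restriction_of f RB_class.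
Proof.
move=> [fu [m_ [U [Us Uorth Ut _]]]].
set M := (\sum_k m_ k)%N in U Us Uorth Ut.
have UU : U *m U = 1%:M by rewrite -{2}Us.
pose N : 'M[R]_(M + n) := 2^-1 *: (1%:M - U).
have UN : U *m N = - N.
  by rewrite -scalemxAr mulmxBr mulmx1 UU -scalerN opprB.
have fixN p (y : 'M[C]_(M + n, p)) : cmx U *m y = - y -> cmx N *m y = y.
  move=> Uy; rewrite map_mxZ map_mxB map_mx1 -scalemxAl mulmxBl mul1mx Uy opprK.
  apply/matrixP => i j; rewrite mxE mxE.
  by rewrite fmorphV rmorph_nat; field.
pose K := dsubmx N.
have key z : polyhalfplane z -> exists W : 'M[C]_(M, n), exists W' : 'M[C]_(M, n),
    [/\ cmx U *m col_mx (- W) 1%:M = - col_mx (- W) 1%:M,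
        cmx U *m col_mx W' (f z) = col_mx W' (f z) &
        diag_P m_ z *m W = W'].
  move=> zP; have [zeta zD zE] := cayley_surj zP.
  have [Pu] := Ut zeta zD; rewrite /double_cayley zE /transfer_function.
  set A := ulsubmx _ in Pu *; set B := ursubmx _; set D := drsubmx _.
  set E := dlsubmx _; set P := diag_P m_ zeta in Pu *.
  pose Xi := invmx (1%:M - P *m A) *m P *m B.
  pose th := A *m Xi + B.
  (* This normalization gives V - G V = 1 and V + G V = f(z), so the difference and the sum of (Xi,
     1) V and its image under U end in 1 and in f(z). *)
  pose V := 2^-1 *: (f z + 1%:M).
  rewrite (_ : D + _ = D + E *m Xi); last by rewrite /Xi !mulmxA.
  set G := D + E *m Xi => GE.
  have two0 : (2 : C) != 0 by rewrite pnatr_eq0.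
  have GV : G *m V = 2^-1 *: (f z - 1%:M).
    by rewrite -scalemxAr -GE mulmxKV // fu.
  have V1 : V - G *m V = 1%:M.
    rewrite GV; apply/matrixP => i j; rewrite !mxE.
    by case: (i == j); rewrite ?mulr1n ?mulr0n /=; field.
  have V2 : V + G *m V = f z.
    rewrite GV; apply/matrixP => i j; rewrite !mxE.
    by case: (i == j); rewrite ?mulr1n ?mulr0n /=; field.
  have XP : Xi = P *m th.
    have : (1%:M - P *m A) *m Xi = P *m B by rewrite /Xi -!mulmxA mulKVmx.
    rewrite mulmxBl mul1mx => /eqP; rewrite subr_eq => /eqP {1}->.
    by rewrite /th mulmxDr (mulmxA P A) addrC.
  have U1 : cmx U *m col_mx Xi 1%:M = col_mx th G.
    by rewrite -[cmx U]submxK mul_block_col !mulmx1 [G]addrC.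
  have U2 : cmx U *m col_mx th G = col_mx Xi 1%:M.
    by rewrite -U1 mulmxA -map_mxM UU map_mx1 mul1mx.
  exists ((th - Xi) *m V), ((th + Xi) *m V); split.
  - have -> : col_mx (- ((th - Xi) *m V)) 1%:M = (col_mx Xi 1%:M - col_mx th G) *m V.
      have V1' : (1%:M - G) *m V = 1%:M by rewrite mulmxBl mul1mx.
      rewrite opp_col_mx add_col_mx mul_col_mx V1'.
      by rewrite -mulNmx opprB.
    by rewrite mulmxA mulmxBr U1 U2 -mulNmx opprB.
  - have -> : col_mx ((th + Xi) *m V) (f z) = (col_mx Xi 1%:M + col_mx th G) *m V.
      have V2' : (1%:M + G) *m V = f z by rewrite mulmxDl mul1mx.
      by rewrite add_col_mx mul_col_mx V2' [th + _]addrC.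
    by rewrite mulmxA mulmxDr U1 U2 [col_mx th G + _]addrC.
  - rewrite mulmxA; congr (_ *m V).
    have ZP : diag_P m_ z *m (1%:M - P) = 1%:M + P.
      have wE : 1%:M - P = diag_P m_ (\row_k (1 - zeta 0 k)).
        apply/eqP; rewrite subr_eq; apply/eqP/esym; rewrite -diag_P1.
        by apply: diag_PD => k; rewrite !mxE subrK.
      rewrite wE -diag_P1 (@diag_PD _ _ _ _ _ (\row_k (1 + zeta 0 k))).
        apply: diag_PM => k; rewrite -zE !mxE divfK //; exact: polydisk_neq1.
      by move=> k; rewrite !mxE.
    have -> : th - Xi = (1%:M - P) *m th by rewrite mulmxBl mul1mx -XP.
    by rewrite mulmxA ZP mulmxDl mul1mx -XP.
have fixK W : cmx U *m col_mx (- W) 1%:M = - col_mx (- W) 1%:M ->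
    cmx K *m col_mx (- W) 1%:M = 1%:M :> 'M[C]_n.
  move=> UW; have NW := fixN _ _ UW; rewrite /K map_dsubmx.
  by rewrite -[cmx N]vsubmxK mul_col_mx in NW; case/eq_col_mx: NW.
(* The last n rows of N are independent, because N fixes a block whose last n rows form the
   identity. *)
have /row_freeP[H0 KH] : row_free K.
  rewrite -(row_free_map (real_complex R)); apply/row_freeP.
  have [W [W' [UW _ _]]] := key ones ones_halfplane.
  by exists (col_mx (- W) 1%:M); exact: fixK UW.
(* The right inverse [H0] of K makes the last n rows exactly (1 0), while the left factor N keeps
   the columns in the eigenspace and T (1, y) = y for the blocks y = (-W, 1). *)
pose T : 'M[R]_(M + n, n + (M + n)) := N *m row_mx H0 (1%:M - H0 *m K).
have UT : U *m T = - T by rewrite mulmxA UN mulNmx.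
have dT : dsubmx T = row_mx 1%:M 0.
  rewrite /T -[N]vsubmxK mul_col_mx col_mxKd mul_mx_row -/K KH mulmxBr mulmx1.
  by rewrite mulmxA KH mul1mx subrr.
pose S : 'M[R]_(M, n + (M + n)) := - usubmx T.
have TE : T = col_mx (- S) (row_mx 1%:M 0) by rewrite opprK -dT vsubmxK.
pose A k := (submxcol S k)^T *m submxcol S k.
have Ap k : real_psd_mx (A k).
  split; first by rewrite trmx_mul trmxK.
  move=> x; rewrite mulmxA -trmx_mul -mulmxA mxE; apply: sumr_ge0 => i _.
  by rewrite mxE -expr2 sqr_ge0.
have AE z : mx_pencil A z = (cmx S)^T *m diag_P m_ z *m cmx S.
  by rewrite -{1 2}[S]submxcolK pencil_of_blocks.
have AY z : polyhalfplane z -> exists Y, mx_pencil A z *m col_mx 1%:M Y = col_mx (f z) 0.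
  move=> zP; have [W [W' [UW UW' ZW]]] := key z zP.
  pose y := col_mx (- W) (1%:M : 'M[C]_n); exists y.
  have Ty : cmx T *m col_mx 1%:M y = y.
    rewrite /T map_mxM -mulmxA map_row_mx mul_row_col mulmx1 map_mxB map_mx1.
    rewrite mulmxBl mul1mx map_mxM -mulmxA (fixK W UW) mulmx1 addrC subrK.
    exact: fixN.
  have Sy : cmx S *m col_mx 1%:M y = W.
    have := Ty; rewrite {1}TE map_col_mx mul_col_mx map_mxN mulNmx.
    by case/eq_col_mx => /oppr_inj.
  (* Eigenvectors of the symmetric matrix U for -1 and for 1 are orthogonal. *)
  have TW : (cmx T)^T *m col_mx W' (f z) = 0.
    have vN : (cmx T)^T *m col_mx W' (f z) = - ((cmx T)^T *m col_mx W' (f z)).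
      have TU : (cmx T)^T *m cmx U = - (cmx T)^T.
        by rewrite map_trmx -map_mxM -[U in LHS]Us -trmx_mul UT raddfN map_mxN.
      by rewrite -mulNmx -TU -mulmxA UW'.
    apply/matrixP => i j; have /matrixP/(_ i j)/eqP := vN.
    by rewrite eq_sym [X in X == _]mxE eqNr => /eqP ->; rewrite mxE.
  rewrite AE -!mulmxA Sy ZW.
  move: TW; rewrite TE map_col_mx tr_col_mx mul_row_col map_mxN raddfN /= mulNmx.
  rewrite addrC => /eqP; rewrite subr_eq0 => /eqP <-.
  rewrite map_row_mx tr_row_mx map_mx1 map_mx0 trmx1 trmx0 mul_col_mx mul1mx.
  by rewrite mul0mx.
have [m' [A' [A'p A'd A'Y]]] := pencil_reduction Ap.
apply: (RB_of_pencil A'p A'd) => z zP; have [Y YE] := AY z zP.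
exact: A'Y YE.
Qed.

End TransferRealization.

(** * Operator pencils *)

Section HilbertRealization.
Context {R : realType} {d n : nat} (H : hilbertSpace R).
Local Notation C := R[i].
Local Notation cmx := (map_mx (real_complex R)).
Local Notation E := ('cV[C]_n * H)%type.
Implicit Types x y : E.

Lemma hdotDl (u v w : H) : hdot H (u + v) w = hdot H u w + hdot H v w.
Proof. exact: linearDl. Qed.

Lemma hdotDr (u v w : H) : hdot H w (u + v) = hdot H w u + hdot H w v.
Proof. exact: linearDr. Qed.

Lemma hdotZl c (u w : H) : hdot H (c *: u) w = c * hdot H u w.
Proof. exact: linearZl_LR. Qed.

Lemma hdotZr c (u w : H) : hdot H w (c *: u) = Num.conj c * hdot H w u.
Proof. exact: linearZr_LR. Qed.

Lemma hdotC (u w : H) : hdot H u w = Num.conj (hdot H w u).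
Proof. by have := @hermC _ _ _ _ (hdot H) u w; rewrite expr0 mul1r. Qed.

Lemma hdot_ext (u v : H) : (forall w, hdot H u w = hdot H v w) -> u = v.
Proof.
move=> uv; apply/subr0_eq/eqP; rewrite -(dnorm_eq0 (hdot H)).
have := uv (u - v) => e.
by rewrite hdotDl e -hdotDl subrr linear0l.
Qed.

Lemma cdotC (u v : 'cV[C]_n) : cdot u v = Num.conj (cdot v u).
Proof.
by rewrite !cdotE rmorph_sum; apply: eq_bigr => k _; rewrite rmorphM /= conjCK mulrC.
Qed.

Lemma sum_dotDl x y w : sum_dot (x + y) w = sum_dot x w + sum_dot y w.
Proof.
by rewrite /sum_dot hdotDl /cdot mulmxDr mxE addrACA.
Qed.

Lemma sum_dotZl c x w : sum_dot (c *: x) w = c * sum_dot x w.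
Proof.
by rewrite /sum_dot hdotZl /cdot -scalemxAr mxE mulrDr.
Qed.

Lemma sum_dotC x w : sum_dot x w = Num.conj (sum_dot w x).
Proof. by rewrite /sum_dot rmorphD /= -cdotC -hdotC. Qed.

Lemma sum_dotDr x y w : sum_dot w (x + y) = sum_dot w x + sum_dot w y.
Proof. by rewrite sum_dotC sum_dotDl rmorphD /= -!sum_dotC. Qed.

Lemma sum_dotZr c x w : sum_dot w (c *: x) = Num.conj c * sum_dot w x.
Proof. by rewrite sum_dotC sum_dotZl rmorphM /= -sum_dotC. Qed.

Lemma sum_dot_suml I (r : seq I) (F : I -> E) w :
  sum_dot (\sum_(i <- r) F i) w = \sum_(i <- r) sum_dot (F i) w.
Proof.
apply: (big_morph (fun x => sum_dot x w)) => [x y|]; first exact: sum_dotDl.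
by rewrite -(scale0r (0 : E)) sum_dotZl mul0r.
Qed.

Lemma sum_dot_sumr I (r : seq I) (F : I -> E) w :
  sum_dot w (\sum_(i <- r) F i) = \sum_(i <- r) sum_dot w (F i).
Proof.
apply: (big_morph (sum_dot w)) => [x y|]; first exact: sum_dotDr.
by rewrite -(scale0r (0 : E)) sum_dotZr rmorph0 mul0r.
Qed.

Section AntiUnitary.
Variable iota : H -> H.
Hypothesis iota_inv : antiunitary_involution (hdot H) iota.

Let iotaK : involutive iota := iota_inv.1.

Let hdot_iota u v : hdot H (iota u) v = hdot H (iota v) u.
Proof. by rewrite -{1}[v]iotaK iota_inv.2. Qed.

(** Antilinearity is not part of the definition of the involution: it follows by pairing with an
    arbitrary w, as the involution can be moved onto w. *)
Lemma iotaD u v : iota (u + v) = iota u + iota v.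
Proof.
apply: hdot_ext => w; rewrite hdotDl !(hdot_iota _ w).
by rewrite hdotDr.
Qed.

Lemma iotaZ c u : iota (c *: u) = Num.conj c *: iota u.
Proof.
by apply: hdot_ext => w; rewrite hdotZl !(hdot_iota _ w) hdotZr.
Qed.

Lemma iota0 : iota 0 = 0.
Proof. by have := iotaZ 0 0; rewrite scale0r rmorph0 scale0r. Qed.

Let conj_sum := @sum_conj R n H iota.

Lemma sum_conjD x y : conj_sum (x + y) = conj_sum x + conj_sum y.
Proof. by rewrite /conj_sum /sum_conj map_mxD iotaD. Qed.

Lemma sum_conjZ c x : conj_sum (c *: x) = Num.conj c *: conj_sum x.
Proof. by rewrite /conj_sum /sum_conj map_mxZ iotaZ. Qed.

Lemma sum_dot_conj x y :
  sum_dot (conj_sum x) (conj_sum y) = Num.conj (sum_dot x y).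
Proof.
rewrite /sum_dot iota_inv.2 rmorphD /= -hdotC; congr (_ + _).
rewrite !cdotE rmorph_sum; apply: eq_bigr => k _.
by rewrite rmorphM /= !mxE.
Qed.

Variable A : 'I_d -> {linear E -> E}.
Hypothesis A_real : forall j x, conj_sum (A j x) = A j (conj_sum x).
Hypothesis A_psd : forall j, psd_op (@sum_dot R n H) (A j).

Lemma op_pencilD z x y : op_pencil A z (x + y) = op_pencil A z x + op_pencil A z y.
Proof.
by rewrite -big_split; apply: eq_bigr => k _; rewrite linearD scalerDr.
Qed.

Lemma op_pencil_conj (x : 'rV[R]_d) y :
  op_pencil A (cmx x) (conj_sum y) = conj_sum (op_pencil A (cmx x) y).
Proof.
rewrite /op_pencil (big_morph conj_sum sum_conjD (_ : conj_sum 0 = 0)).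
  apply: eq_bigr => k _.
  by rewrite sum_conjZ mxE conj_real A_real.
by rewrite /conj_sum /sum_conj map_mx0 iota0.
Qed.

Variable h : 'rV[C]_d -> 'I_n -> H.
Let psi z j : E := (delta_mx j 0, - h z j).

(** The analogue of psi(w)^* A_k psi(z) for a matrix pencil, with h(z, j) in the role of A_22(z)^-1
    A_21(z) e_j. *)
Definition op_kernel k w z : 'M[C]_n :=
  \matrix_(i, j) sum_dot (A k (psi z j)) (psi w i).

Lemma op_kernel_positive k L : positive_kernel L (op_kernel k).
Proof.
move=> N l u _.
pose V : E := \sum_j \sum_b u j b 0 *: psi (l j) b.
have -> : \sum_i \sum_j cdot (op_kernel k (l i) (l j) *m u j) (u i) =
    sum_dot (A k V) V.
  rewrite {2}/V sum_dot_sumr; apply: eq_bigr => i _.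
  rewrite sum_dot_sumr (eq_bigr (fun j => \sum_a Num.conj (u i a 0) *
    \sum_b u j b 0 * sum_dot (A k (psi (l j) b)) (psi (l i) a))); last first.
    move=> j _; rewrite cdotE; apply: eq_bigr => a _; rewrite mxE.
    by congr (_ * _); apply: eq_bigr => b _; rewrite !mxE mulrC.
  rewrite exchange_big; apply: eq_bigr => a _ /=.
  rewrite sum_dotZr -mulr_sumr; congr (_ * _).
  rewrite /V linear_sum sum_dot_suml; apply: eq_bigr => j _.
  rewrite linear_sum sum_dot_suml; apply: eq_bigr => b _.
  by rewrite linearZ sum_dotZl.
exact: A_psd.
Qed.

Variable F : 'rV[C]_d -> 'M[C]_n.
Hypothesis h_op22 : forall z j, Omega z ->
  op22 A z (h z j) = op21 A z (delta_mx j 0).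
Hypothesis h_op12 : forall z j, Omega z ->
  F z *m delta_mx j 0 = op11 A z (delta_mx j 0) - op12 A z (h z j).

Let op_pencil_psi z j : Omega z ->
  op_pencil A z (psi z j) = (F z *m delta_mx j 0, 0).
Proof.
move=> zO; have psiE : psi z j = (delta_mx j 0, 0) - (0, h z j).
  by rewrite /psi; congr (_, _); rewrite ?subr0 ?sub0r.
have op_pencilN y : op_pencil A z (- y) = - op_pencil A z y.
  by rewrite -sumrN; apply: eq_bigr => k _; rewrite linearN scalerN.
rewrite psiE op_pencilD op_pencilN h_op12 //.
have := h_op22 j zO; rewrite /op11 /op12 /op22 /op21.
case: (op_pencil A z ((delta_mx j 0, 0) : E)) => a b.
case: (op_pencil A z ((0, h z j) : E)) => c e /= ->.
by congr (_, _); rewrite subrr.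
Qed.

Lemma op_kernel_sum w z : Omega w -> Omega z ->
  F z = \sum_k z 0 k *: op_kernel k w z.
Proof.
move=> wO zO; apply/matrixP => i j; rewrite summxE.
transitivity (sum_dot (op_pencil A z (psi z j)) (psi w i)).
  rewrite op_pencil_psi // /sum_dot /= linear0l addr0.
  have := @cdot_delta R n (F z) 1 1 i j; rewrite !scale1r => ->.
  by rewrite rmorph1 !mul1r.
rewrite sum_dot_suml; apply: eq_bigr => k _.
by rewrite sum_dotZl !mxE.
Qed.

Hypothesis op22_inj : forall z, Omega z -> injective (op22 A z).

(** At a positive real point the pencil commutes with the conjugation, so the conjugate of h solves
    the same equation as h; injectivity of A_22 makes h real. *)
Lemma op_kernel_real k w z : positive_reals w -> positive_reals z ->
  map_mx Num.conj (op_kernel k w z) = op_kernel k w z.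
Proof.
have hr v j : positive_reals v -> iota (h v j) = h v j.
  move=> vP; have vO := positive_reals_Omega vP.
  apply: (op22_inj vO); rewrite h_op22 //; case: vP => x _ vE.
  have c0 : conj_sum (0, h v j) = (0, iota (h v j)).
    by rewrite /conj_sum /sum_conj map_mx0.
  have ce : conj_sum (delta_mx j 0, 0) = (delta_mx j 0, 0).
    by rewrite /conj_sum /sum_conj iota0 /= map_delta_mx.
  rewrite /op22 -c0 vE op_pencil_conj -vE /= -/(op22 A v (h v j)) h_op22 //.
  by rewrite /op21 -{2}ce {2}vE op_pencil_conj -vE.
have psir v j : positive_reals v -> conj_sum (psi v j) = psi v j.
  move=> vP; rewrite /conj_sum /sum_conj /psi /= map_delta_mx.
  by rewrite -scaleN1r iotaZ hr // rmorphN1.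
move=> wP zP; apply/matrixP => i j; rewrite !mxE -sum_dot_conj A_real.
by rewrite !psir.
Qed.

End AntiUnitary.

End HilbertRealization.

(** The solutions h are picked pointwise by choice, so the kernels come with positivity and reality
    only, which is what [weak_realization] asks of them; rationality and holomorphy are those of
    F. *)
Lemma RBrat_RB {R : realType} {d n : nat} (f : 'rV[R[i]]_d -> 'M[R[i]]_n) :
  restriction_of f RBrat_class -> restriction_of f RB_class.
Proof.
move=> [F fF [Frat Fhol [H [iota [A [io Ab Ap Ar FB]]]]]]; apply: (restriction_RB fF).
have hE : forall t : 'rV[R[i]]_d * 'I_n, exists h : H, Omega t.1 ->
    op22 A t.1 h = op21 A t.1 (delta_mx t.2 0) /\
    F t.1 *m delta_mx t.2 0 = op11 A t.1 (delta_mx t.2 0) - op12 A t.1 h.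
  move=> t; have [tO|tO] := pselect (Omega t.1); last by exists 0.
  have [B [_ _ BK FE]] := FB _ tO.
  by exists (B (op21 A t.1 (delta_mx t.2 0))) => _; rewrite BK FE.
have [h hh] := choice hE.
pose h' z j := h (z, j).
have h22 z j : Omega z -> op22 A z (h' z j) = op21 A z (delta_mx j 0).
  by move=> zO; exact: (hh (z, j) zO).1.
have h12 z j : Omega z ->
    F z *m delta_mx j 0 = op11 A z (delta_mx j 0) - op12 A z (h' z j).
  by move=> zO; exact: (hh (z, j) zO).2.
have inj22 z : Omega z -> injective (op22 A z).
  by move=> /FB[B [_ BK _ _]]; exact: can_inj BK.
have OP z : polyhalfplane z -> Omega (z : 'rV[R[i]]_d) by exact: polyhalfplane_Omega.
apply: (@weak_realization R d n F (op_kernel A h')).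
- move=> i j; have [P [Q [Q0 PQ]]] := Frat i j.
  by exists P, Q; split=> // z zP; apply: PQ; exact: OP.
- by move=> i j z zP; apply: Fhol; exact: OP.
- by move=> k; exact: op_kernel_positive.
- move=> k w z; exact: (op_kernel_real io Ar h22 inj22).
- move=> w z /positive_reals_Omega wO /positive_reals_Omega zO.
  exact: (op_kernel_sum h22 h12).
Qed.

(** * Realization of a matrix pencil on a finite-dimensional Hilbert space *)

Section ColumnHilbertSpace.
Context {R : realType}.
Local Notation C := R[i].

Section Dot.
Context {m : nat}.
Local Notation V := 'cV[C]_m.

Lemma cdot_zmodl (v : V) : zmod_morphism (cdot^~ v).
Proof.
move=> u w /=; rewrite !cdotE -sumrB; apply: eq_bigr => k _.
by rewrite !mxE mulrBr.
Qed.

Lemma cdot_conj (u v : V) : cdot u v = (-1) ^+ false * Num.conj (cdot v u).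
Proof. by rewrite expr0 mul1r; exact: cdotC. Qed.

Lemma cdot_zmodr (u : V) : zmod_morphism (cdot u).
Proof.
move=> v w; rewrite !(cdot_conj u) expr0 !mul1r cdot_zmodl.
by rewrite rmorphB.
Qed.

Lemma cdot_scalel (v : V) : scalable_for *%R (cdot^~ v).
Proof. by move=> c u; rewrite /cdot -scalemxAr mxE. Qed.

Lemma cdot_scaler (u : V) : scalable_for (Num.conj \; *%R) (cdot u).
Proof.
by move=> c v; rewrite !(cdot_conj u) expr0 !mul1r cdot_scalel rmorphM.
Qed.

Lemma cdot_norm (u : V) : cdot u u = \sum_k `|u k 0| ^+ 2.
Proof. by rewrite cdotE; apply: eq_bigr => k _; rewrite mulrC -normCK. Qed.

Lemma cdot_gt0 (u : V) : u != 0 -> 0 < cdot u u.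
Proof.
move=> u0; rewrite cdot_norm lt_def sumr_ge0 => [|k _]; last exact: exprn_ge0.
rewrite andbT; apply: contra u0 => /eqP s0; apply/eqP/colP => k; rewrite mxE.
have := psumr_eq0P (fun k _ => exprn_ge0 2 (normr_ge0 (u k 0))) s0.
by move/(_ k isT)/eqP; rewrite expf_eq0 normr_eq0 => /eqP.
Qed.

Definition cvdot (u v : V) : C := cdot u v.

HB.instance Definition _ := @isBilinear.Build C V V C *%R (Num.conj \; *%R) cvdot
  cdot_zmodl cdot_zmodr cdot_scalel cdot_scaler.
HB.instance Definition _ := @isHermitianSesquilinear.Build C V false Num.conj cvdot
  cdot_conj.
HB.instance Definition _ := @isDotProduct.Build C V cvdot cdot_gt0.

End Dot.

Local Notation vnorm := (dnorm cdot).

Lemma vnorm_ge0 m (u : 'cV[C]_m) : 0 <= vnorm u.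
Proof. by rewrite sqrtC_ge0 cdot_norm sumr_ge0 // => k _; exact: exprn_ge0. Qed.

Lemma vnorm_coord m (u : 'cV[C]_m) k : `|u k 0| <= vnorm u.
Proof.
rewrite -(@ler_pXn2r _ 2) ?nnegrE ?vnorm_ge0 // sqrtCK cdot_norm (bigD1 k) //=.
by rewrite lerDl sumr_ge0 // => i _; exact: exprn_ge0.
Qed.

Lemma vnorm_sum m (u : 'cV[C]_m) : vnorm u <= \sum_k `|u k 0|.
Proof.
have s0 : 0 <= \sum_k `|u k 0| by exact: sumr_ge0.
rewrite -(@ler_pXn2r _ 2) ?nnegrE ?vnorm_ge0 // sqrtCK cdot_norm.
rewrite expr2 mulr_suml; apply: ler_sum => k _.
rewrite expr2 ler_wpM2l // (bigD1 k) //= lerDl; exact: sumr_ge0.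
Qed.

Lemma vnorm_mulmx m p (M : 'M[C]_(p, m)) : exists c : R,
  forall u : 'cV[C]_m, vnorm (M *m u) <= c%:C%C * vnorm u.
Proof.
pose c := \sum_i \sum_j `|M i j|; exists (complex.Re c) => u.
have -> : ((complex.Re c)%:C)%C = c.
  by rewrite RRe_real // ger0_real // sumr_ge0 // => i _; exact: sumr_ge0.
apply: le_trans (vnorm_sum _) _; rewrite mulr_suml; apply: ler_sum => i _.
rewrite mxE mulr_suml; apply: le_trans (ler_norm_sum _ _ _) _.
by apply: ler_sum => j _; rewrite normrM ler_wpM2l // vnorm_coord.
Qed.

Lemma cauchy_real_cvg (u : nat -> R) :
  (forall e, 0 < e -> exists N, forall i j, (N <= i)%N -> (N <= j)%N ->
     `|u i - u j| < e) ->
  exists l, forall e, 0 < e -> exists N, forall i, (N <= i)%N -> `|u i - l| < e.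
Proof.
move=> uC; have : cvg (u @ \oo).
  apply: cauchy_cvg; apply: cauchy_exP => e e0; have [N Nu] := uC e e0.
  exists (u N); exists N => // i /= Ni; rewrite -ball_normE /=; exact: Nu.
move=> /cvg_ex[l /= ul]; exists l => e e0.
have [N _ Nl] := (cvgrPdist_lt _ _).1 ul e e0.
by exists N => i Ni; rewrite distrC; exact: Nl.
Qed.

Lemma normc_ge_Im (c : C) : (`|complex.Im c|%:C)%C <= `|c|.
Proof.
have -> : complex.Im c = complex.Re (- 'i * c).
  by case: c => a b /=; rewrite oppr0 mul0r sub0r mulN1r opprK.
by rewrite (le_trans (normc_ge_Re _)) // normrM normrN normCi mul1r.
Qed.

Lemma complex_norm_le (c : C) (e : R) :
  `|complex.Re c| < e / 2 -> `|complex.Im c| < e / 2 -> `|c| < e%:C%C.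
Proof.
move=> re im; rewrite [c]complexE; apply: le_lt_trans (ler_normD _ _) _.
rewrite normrM.
have -> : `|'i%C| = 1 :> C by rewrite normc_def /= expr0n add0r expr1n sqrtr1.
rewrite mul1r !normc_def /= !expr0n /= !addr0 !sqrtr_sqr.
by rewrite -rmorphD ltcR [ltRHS]splitr ltrD.
Qed.

Lemma vnorm_complete m : complete_for (@cdot R m).
Proof.
move=> u uC.
have cauchy_part (p : C -> R) : (forall a b, p (a - b) = p a - p b) ->
    (forall c, (`|p c|%:C)%C <= `|c|) -> forall k, exists l, forall e, 0 < e ->
    exists N, forall i, (N <= i)%N -> `|p (u i k 0) - l| < e.
  move=> pB pn k; apply: cauchy_real_cvg => e e0; have [N Nu] := uC e e0.
  exists N => i j Ni Nj; rewrite -ltcR -pB; apply: le_lt_trans (pn _) _.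
  apply: le_lt_trans (Nu i j Ni Nj); have := vnorm_coord (u i - u j) k.
  by rewrite !mxE.
have /fin_all_exists[a aP] : forall k, _ := cauchy_part (@complex.Re R)
  (fun a b => raddfB (@complex.Re R) a b) (@normc_ge_Re R).
have /fin_all_exists[b bP] : forall k, _ := cauchy_part (@complex.Im R)
  (fun a b => raddfB (@complex.Im R) a b) normc_ge_Im.
exists (\col_k (a k +i* b k)%C) => e e0.
(* With m + 1 instead of m the division makes sense for m = 0, and m terms sum to strictly less than
   e. *)
pose e' := e / m.+1%:R.
have e'0 : 0 < e' / 2 by rewrite !divr_gt0.
have /fin_all_exists[Na NaP] := fun k => aP k _ e'0.
have /fin_all_exists[Nb NbP] := fun k => bP k _ e'0.
exists (\max_k maxn (Na k) (Nb k)) => i Ni; apply: le_lt_trans (vnorm_sum _) _.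
apply: (@le_lt_trans _ _ (\sum_(k < m) e'%:C%C)).
  apply: ler_sum => k _; apply/ltW; rewrite !mxE.
  have [Nai Nbi] : (Na k <= i)%N /\ (Nb k <= i)%N.
    by apply/andP; rewrite -geq_max (leq_trans _ Ni) // leq_bigmax.
  apply: complex_norm_le; [have := NaP k i Nai|have := NbP k i Nbi];
    by case: (u i k 0).
rewrite sumr_const card_ord -rmorphMn ltcR -mulr_natr /e' mulrAC ltr_pdivrMr //.
by rewrite ltr_pM2l // ltr_nat.
Qed.

Definition column_hilbert m : hilbertSpace R :=
  @HilbertSpace R 'cV[C]_m (@cvdot m) (@vnorm_complete m).

End ColumnHilbertSpace.

Section PencilToOperators.
Context {R : realType} {d n : nat}.
Local Notation C := R[i].
Local Notation cmx := (map_mx (real_complex R)).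

Section BlockOperator.
Context {m : nat}.
Local Notation H := (@column_hilbert R m).
Local Notation E := ('cV[C]_n * H)%type.
Implicit Types (M : 'M[C]_(n + m)) (x y : E).

Definition stack x : 'cV[C]_(n + m) := col_mx x.1 (x.2 : 'cV[C]_m).

Definition unstack (v : 'cV[C]_(n + m)) : E := (usubmx v, dsubmx v).

Lemma stackK : cancel stack unstack.
Proof. by case=> u v; rewrite /unstack col_mxKu col_mxKd. Qed.

Lemma unstackK : cancel unstack stack.
Proof. by move=> v; rewrite /stack vsubmxK. Qed.

Lemma sum_dot_stack x y : sum_dot x y = cdot (stack x) (stack y).
Proof.
rewrite [RHS]cdotE big_split_ord /sum_dot [cdot _ _]cdotE; congr (_ + _).
  by apply: eq_bigr => k _; rewrite /stack !col_mxEu.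
rewrite [LHS](_ : _ = cdot (x.2 : 'cV_m) y.2) // cdotE.
by apply: eq_bigr => k _; rewrite /stack !col_mxEd.
Qed.

Definition block_op M x : E := unstack (M *m stack x).

Lemma block_opE M u (v : 'cV[C]_m) : block_op M (u, v) =
  (ulsubmx M *m u + ursubmx M *m v, dlsubmx M *m u + drsubmx M *m v).
Proof.
rewrite /block_op /stack -{1}[M]submxK mul_block_col /unstack.
by rewrite col_mxKu col_mxKd.
Qed.

Lemma block_op_linear M : linear (block_op M).
Proof.
move=> c x y; rewrite /block_op.
have -> : stack (c *: x + y) = c *: stack x + stack y.
  by rewrite /stack scale_col_mx add_col_mx.
by rewrite mulmxDr -scalemxAr /unstack !linearP.
Qed.

HB.instance Definition _ M := GRing.isLinear.Build C E E *:%R (block_op M)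
  (block_op_linear M).

Lemma block_op_bounded M : bounded_op (@sum_dot R n H) (block_op M).
Proof.
have [c cP] := vnorm_mulmx M; exists c => x.
by have := cP (stack x); rewrite /dnorm !sum_dot_stack unstackK.
Qed.

End BlockOperator.

Lemma RB_RBrat (f : 'rV[C]_d -> 'M[C]_n) :
  restriction_of f RB_class -> restriction_of f RBrat_class.
Proof.
move=> /RB_pencil[m [A [Ap Ad fA]]].
exists (fun z => schur_compl (mx_pencil A z)) => //.
have Ad0 z : Omega z -> \det (drsubmx (mx_pencil A z)) != 0.
  exact: drsub_det_Omega Ap Ad.
have [rA hA] : rational_on Omega (fun z => schur_compl (mx_pencil A z)) /\
    holomorphic_on Omega (fun z => schur_compl (mx_pencil A z)).
  apply: regfun_rational_holomorphic; first by eexists; exact: ones_Omega.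
  exact: schur_compl_regfun.
split=> //; pose H := @column_hilbert R m.
pose T j : {linear ('cV[C]_n * H)%type -> ('cV[C]_n * H)%type} :=
  @block_op m (cmx (A j)).
have TE z x : op_pencil T z x = block_op (mx_pencil A z) x.
  rewrite /op_pencil /block_op /mx_pencil mulmx_suml.
  apply: (can_inj stackK); rewrite unstackK.
  rewrite (big_morph stack (id1 := 0) (op1 := +%R)).
  - apply: eq_bigr => j _; rewrite -scalemxAl -[in RHS](unstackK (_ *m _)).
    by rewrite /stack scale_col_mx.
  - by move=> x1 x2; rewrite /stack add_col_mx.
  - by rewrite /stack col_mx0.
exists H, (map_mx Num.conj : H -> H), T; split.
- split=> [v|u v].
    by apply/matrixP => i j; rewrite !mxE conjCK.
  rewrite /= /cvdot !cdotE; apply: eq_bigr => k _.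
  by rewrite !mxE conjCK mulrC.
- by move=> j; exact: block_op_bounded.
- move=> j x; rewrite sum_dot_stack unstackK.
  (* Semidefiniteness of A_j is given on real vectors; [psd_form] carries it to complex ones. *)
  have [r [r0 rE _]] := psd_form (stack x) (Ap j).
  by rewrite /cdot mulmxA rE ler0c.
- move=> j x; apply: (can_inj stackK).
  have stack_conj y : stack (@sum_conj R n H (map_mx Num.conj) y) =
      map_mx Num.conj (stack y) by rewrite /stack map_col_mx.
  by rewrite stack_conj /= !unstackK map_mxM /= conj_cmx stack_conj.
- move=> z zO; have uA : drsubmx (mx_pencil A z) \in unitmx.
    by rewrite unitmxE unitfE Ad0.
  have op22E v : op22 T z v = drsubmx (mx_pencil A z) *m v.
    by rewrite /op22 TE block_opE /= mulmx0 add0r.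
  exists (mulmx (invmx (drsubmx (mx_pencil A z)))); split.
  + exact: vnorm_mulmx.
  + by move=> v; rewrite op22E; exact: mulKmx.
  + by move=> v; rewrite op22E; exact: mulKVmx.
  move=> u; rewrite /op11 /op12 /op21 !TE !block_opE /= !mulmx0 !addr0 add0r.
  by rewrite /schur_compl mulmxBl !mulmxA.
Qed.

End PencilToOperators.

Theorem theorem4p1 (R : realType) (d n : nat) (hd : (0 < d)%N) (hn : (0 < n)%N)
    (f : 'rV[R[i]]_d -> 'M[R[i]]_n) :
  [<->
    restriction_of f RB_class;
    restriction_of f RBrat_class;
    restriction_of f (fun F =>
      exists Phi : 'I_d -> 'rV[R[i]]_d -> 'rV[R[i]]_d -> 'M[R[i]]_n,
      [/\ forall k, rational_on Omega2 (conj_left (Phi k)) /\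
                    holomorphic_on Omega2 (conj_left (Phi k)),
          forall k w z, Omega w -> Omega z ->
            Phi k (map_mx Num.conj w) (map_mx Num.conj z)
              = map_mx Num.conj (Phi k w z),
          forall k, positive_kernel Omega (Phi k),
          forall k w z (lambda : R[i]), Omega w -> Omega z -> lambda != 0 ->
            Phi k (lambda *: w) (lambda *: z) = Phi k w z &
          forall w z, Omega w -> Omega z ->
            F z = \sum_(k < d) z 0 k *: Phi k w z]);
    restriction_of f (fun F =>
      exists (N : 'I_d -> nat)
        (phi : forall k : 'I_d, 'rV[R[i]]_d -> 'M[R[i]]_(N k, n)),
      [/\ forall k, rational_on Omega (phi k) /\ holomorphic_on Omega (phi k),
          forall k, real_on Omega (phi k),
          forall k z (lambda : R[i]), Omega z -> lambda != 0 ->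
            phi k (lambda *: z) = phi k z &
          forall w z, Omega w -> Omega z ->
            F z = \sum_(k < d) z 0 k *: ((phi k w) ^t* *m phi k z)]);
    (forall z, polyhalfplane z -> f z + 1%:M \in unitmx) /\
    exists (m_ : 'I_d -> nat) (U : 'M[R]_(\sum_k m_ k + n)),
      [/\ U^T = U, U *m U^T = 1%:M,
          forall zeta, polydisk zeta ->
            1%:M - diag_P m_ zeta *m ulsubmx (map_mx (real_complex R) U)
              \in unitmx /\
            double_cayley f zeta = transfer_function U (diag_P m_ zeta) &
          ~~ eigenvalue (double_cayley f 0) 1]].
Proof.
tfae.
- exact: RB_RBrat.
- by move=> /RBrat_RB; exact: RB_kernel.
- by move=> /kernel_RB; exact: RB_factor.
- by move=> /factor_RB; exact: RB_transfer.
- exact: transfer_RB.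
Qed.
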